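(* Let $n = 9$ and let $C$ be a cubic form in $9$ variables as in the context satisfying Davenport's Geometric Condition. Assume moreover the following hypothesis: for every integer $0 \le r \le 9$ and every $\varepsilon>0$, uniformly for all real $1 \le H \le R$, \[ \#\{(\mathbf{h},p) : \mathbf{h}\in\mathbb{Z}^9,\ \|\mathbf{h}\|_\infty \le H,\ p \text{ prime},\ R < p \le 2R,\ r_p(\mathbf{h}) \le r\} \ll_\varepsilon H^r R^{1+\varepsilon}. \] Then the singular series is absolutely convergent, i.e. $\sum_{q\ge 1}\sum_{\gcd(a,q)=1} |S(q,a)|/q^9 < \infty$.
   Context: Let $C(\mathbf{x}) = \sum_{i,j,k=1}^n c_{ijk} x_i x_j x_k$ be a cubic form with integer coefficients $c_{ijk}$ that are symmetric in $i,j,k$. Let $M(\mathbf{x})$ be the $n\times n$ matrix with entries $M(\mathbf{x})_{jk} = \sum_{i=1}^n c_{ijk} x_i$; $r(\mathbf{x})$ denotes its rank over $\mathbb{Q}$ and, for a prime $p$, $r_p(\mathbf{x})$ denotes the rank over $\mathbb{F}_p$ of its reduction mod $p$. $C$ satisfies Davenport's Geometric Condition if for every integer $0 \le r \le n$ and every $\varepsilon>0$, $\#\{\mathbf{x} \in \mathbb{Z}^n : \|\mathbf{x}\|_\infty \le P,\ r(\mathbf{x}) = r\} \ll_{\varepsilon} P^{r+\varepsilon}$ for all $P\ge1$. Write $e(x)=e^{2\pi i x}$ and $S(q,a) = \sum_{\mathbf{x} \bmod q} e(aC(\mathbf{x})/q)$. *)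

(* Defs.v *)
From mathcomp Require Import all_boot all_order all_algebra.
From mathcomp Require Import all_classical all_reals all_analysis.
Set Implicit Arguments. Unset Strict Implicit. Unset Printing Implicit Defensive.
Import Order.TTheory GRing.Theory Num.Theory.
Local Open Scope ring_scope.

Definition coeffs (n : nat) := 'I_n -> 'I_n -> 'I_n -> int.

Definition symmetric_coeffs n (c : coeffs n) : Prop :=
  forall i j k, c i j k = c j i k /\ c i j k = c i k j.

Definition cubic n (c : coeffs n) (x : 'I_n -> int) : int :=
  \sum_(i < n) \sum_(j < n) \sum_(k < n) c i j k * x i * x j * x k.

Definition Mx n (c : coeffs n) (x : 'I_n -> int) : 'M[int]_n :=
  \matrix_(j < n, k < n) \sum_(i < n) c i j k * x i.

Definition rQ n (c : coeffs n) (x : 'I_n -> int) : nat :=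
  \rank (map_mx (fun z : int => (z%:~R : rat)) (Mx c x)).

Definition rp n (c : coeffs n) (p : nat) (x : 'I_n -> int) : nat :=
  \rank (map_mx (fun z : int => (z%:~R : 'F_p)) (Mx c x)).

(* integer points with coordinates in [-N, N], enumerated by a finite type *)
Definition box_pt n (N : nat) (v : {ffun 'I_n -> 'I_(2 * N).+1}) : 'I_n -> int :=
  fun i => (v i)%:Z - N%:Z.

Definition count_rank (R : realType) n (c : coeffs n) (P : R) (r : nat) : nat :=
  #|[set v : {ffun 'I_n -> 'I_(2 * Num.truncn P).+1} |
      [forall i, (`|box_pt v i|%:~R <= P :> R)] && (rQ c (box_pt v) == r)]|.

Definition davenport_geometric (R : realType) n (c : coeffs n) : Prop :=
  forall (r : nat), (r <= n)%N -> forall eps : R, 0 < eps ->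
    exists K : R, forall P : R, 1 <= P ->
      (count_rank c P r)%:R <= K * P `^ (r%:R + eps).

Definition count_pairs (R : realType) n (c : coeffs n) (H Rr : R) (r : nat) : nat :=
  \sum_(p < (Num.truncn (2 * Rr)).+1 | prime p && (Rr < p%:R) && (p%:R <= 2 * Rr))
    #|[set v : {ffun 'I_n -> 'I_(2 * Num.truncn H).+1} |
        [forall i, (`|box_pt v i|%:~R <= H :> R)] && (rp c p (box_pt v) <= r)%N]|.

Definition pair_hypothesis (R : realType) n (c : coeffs n) : Prop :=
  forall (r : nat), (r <= n)%N -> forall eps : R, 0 < eps ->
    exists K : R, forall H Rr : R, 1 <= H -> H <= Rr ->
      (count_pairs c H Rr r)%:R <= K * H ^+ r * Rr `^ (1 + eps).

(* Real and imaginary parts of S(q,a) = sum_{x mod q} e(a C(x) / q) *)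
Definition S_re (R : realType) n (c : coeffs n) (q a : nat) : R :=
  \sum_(x : {ffun 'I_n -> 'I_q})
     cos (2 * pi * ((a%:Z * cubic c (fun i => (x i)%:Z))%:~R / q%:R)).
Definition S_im (R : realType) n (c : coeffs n) (q a : nat) : R :=
  \sum_(x : {ffun 'I_n -> 'I_q})
     sin (2 * pi * ((a%:Z * cubic c (fun i => (x i)%:Z))%:~R / q%:R)).

Definition S_abs (R : realType) n (c : coeffs n) (q a : nat) : R :=
  Num.sqrt (S_re R c q a ^+ 2 + S_im R c q a ^+ 2).

(* term for q = k+1 : sum_{a mod q, gcd(a,q)=1} |S(q,a)| / q^n *)
Definition sing_term (R : realType) n (c : coeffs n) (k : nat) : R :=
  \sum_(a < k.+1 | coprime a k.+1) S_abs R c k.+1 a / (k.+1)%:R ^+ n.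

(* Main.v *)
(** Let B(x, y) = M(x) y, so that grad C(x) = 3 B(x, x), and let A(q) be the q-th
    term of the series; A is submultiplicative on coprime moduli, so it is enough
    to bound the sum of A(p^k) over all prime powers.  Two inputs control A(p^k).
    - Weyl differencing bounds |S(q,a)|^4 by the number of (h, y) mod q with
      q | 6 B(h, y).  For fixed h (or y) the solutions form a group, so pigeonholing
      into boxes of side about q^(1/2) reduces to B(h, y) = 0 over the integers,
      which the geometric condition counts.  Hence A(q) << q^(-3/25), which handles
      k >= 9 because 9 * 3/25 = 27/25 > 1.
    - For k <= 8 and p > 3, A(p^k) is bounded by means of
      D(p) = sum_(h mod p) p^(- r_p(h)), which the averaged hypothesis (with H = R)
      shows to be p^(1/25) on average, up to a constant: for k = 1 by one
      differencing step and Gauss sums; for k >= 2m by the density of the x with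
      p^m | B(x, x), as translating x by multiples of p^(k-m) kills all other x.
      For m = 1 this density is O(p^(-9/2) D(p)), for m = 2 it is O(p^(-9) D(p)),
      and m = 3 is needed at k = 8 only.
    All in all, the sum of A(p^k) over k >= 1 is O(p^(-27/25) D(p)), and this is
    summable over p by dyadic decomposition. *)
Require Import Defs.
From mathcomp Require Import all_boot all_order all_algebra.
From mathcomp Require Import all_classical all_reals all_analysis.
From mathcomp Require Import complex ring lra zify.
Import Order.TTheory GRing.Theory Num.Theory.
Import numFieldNormedType.Exports.
Local Open Scope ring_scope.
Import Normc.
Set Implicit Arguments. Unset Strict Implicit. Unset Printing Implicit Defensive.

(** * Sums over residue vectors *)

(** Reindexing along a mere injection loses only nonnegative terms. This serves for the Chinese
    remainder map, for splitting a prime power off q, and for the multiples of a degenerate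
    vector. *)
Lemma ler_sum_inj (R : realType) (I J : finType) (P : pred I) (Q : pred J)
    (f : I -> J) (F : J -> R) :
    (forall i j, P i -> P j -> f i = f j -> i = j) ->
    (forall i, P i -> Q (f i)) -> (forall j, Q j -> 0 <= F j) ->
  \sum_(i | P i) F (f i) <= \sum_(j | Q j) F j.
Proof.
move=> finj PQ F0.
pose A := f @: [set i | P i].
have AQ j : j \in A -> Q j by move=> /imsetP [i + ->]; rewrite inE; exact: PQ.
have -> : \sum_(i | P i) F (f i) = \sum_(j in A) F j.
  rewrite big_imset /=; first by apply: eq_bigl => i; rewrite inE.
  by move=> i j; rewrite !inE; exact: finj.
rewrite [X in _ <= X](bigID (mem A)) /=.
rewrite [X in _ <= X + _](eq_bigl (mem A)) => [|j].
  by rewrite lerDl; apply: sumr_ge0 => j /andP[/F0].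
by apply: andb_idl; exact: AQ.
Qed.

Definition resid n q (x : {ffun 'I_n -> 'I_q}) : 'I_n -> int := fun i => (x i)%:Z.

Definition eqmodv n (q : nat) (x y : 'I_n -> int) : Prop :=
  forall i, (x i = y i %[mod q])%Z.

(** Functions on residue classes are encoded as periodic functions on integer vectors, so that
    translating or dilating the argument needs no reduction modulo [q]. *)
Definition mod_periodic n (q : nat) T (f : ('I_n -> int) -> T) : Prop :=
  forall x y, eqmodv q x y -> f x = f y.

Section ResidueSums.
Variables (n : nat) (T : nmodType).
Implicit Types f : ('I_n -> int) -> T.

Lemma eqz_modP (q : nat) (a b : int) : (a = b %[mod q])%Z <-> (q %| a - b)%Z.
Proof. by rewrite -eqz_mod_dvd; split => [/eqP|/eqP]. Qed.

Lemma eqmodvP q (x y : 'I_n -> int) :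
  eqmodv q x y -> exists t, x = y \+ (fun i => q%:Z * t i).
Proof.
move=> h; exists (fun i => ((x i - y i) %/ q)%Z); apply/funext => i /=.
by have /eqz_modP hd := h i; rewrite mulrC divzK // addrC subrK.
Qed.

Lemma mod_periodicP q f :
  (forall x t, f (x \+ (fun i => q%:Z * t i)) = f x) -> mod_periodic q f.
Proof. by move=> h x y /eqmodvP[t ->]. Qed.

Lemma eqmodv_resid q (x y : {ffun 'I_n -> 'I_q}) :
  eqmodv q (resid x) (resid y) -> x = y.
Proof.
move=> h; apply/ffunP => i; apply/val_inj; have := h i.
by rewrite /resid !modz_nat !modn_small // => -[].
Qed.

Lemma resid_surj q (x : 'I_n -> int) :
  (0 < q)%N -> exists v : {ffun 'I_n -> 'I_q}, eqmodv q (resid v) x.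
Proof.
case: q => // q _.
exists [ffun i => inord `|(x i %% q.+1)%Z|%N] => i; rewrite /resid ffunE.
have hi : (0 <= (x i %% q.+1)%Z < q.+1%:Z) by rewrite modz_ge0 // ltz_pmod.
rewrite inordK; last by move: hi; case: (x i %% q.+1)%Z => // k.
by rewrite gez0_abs ?modz_mod //; case/andP: hi.
Qed.

Lemma eqmodv_sym q (x y : 'I_n -> int) : eqmodv q x y -> eqmodv q y x.
Proof. by move=> h i; rewrite h. Qed.

Lemma eqmodv_trans q (y x z : 'I_n -> int) :
  eqmodv q x y -> eqmodv q y z -> eqmodv q x z.
Proof. by move=> h k i; rewrite h. Qed.

(** Pairwise incongruent vectors, [q ^ n] in number, form a complete residue system, because an
    injection between finite sets of equal size is bijective. Translations, x = u + d v and the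
    Chinese remainder form x = m u + d v are the instances used. *)
Lemma sum_residE q (I : finType) (g : I -> 'I_n -> int) f :
    (0 < q)%N -> #|I| = (q ^ n)%N ->
    (forall i j, eqmodv q (g i) (g j) -> i = j) -> mod_periodic q f ->
  \sum_(x : {ffun 'I_n -> 'I_q}) f (resid x) = \sum_(i : I) f (g i).
Proof.
move=> q0 cI ginj fper.
pose s i := projT1 (cid (resid_surj (g i) q0)).
have sE i : eqmodv q (resid (s i)) (g i) := projT2 (cid (resid_surj (g i) q0)).
have sinj : injective s.
  move=> i j ij; apply: ginj; apply: (eqmodv_trans (eqmodv_sym (sE i))).
  by rewrite ij; exact: sE.
have sbij : bijective s.
  by apply: inj_card_bij => //; rewrite card_ffun !card_ord cI.
rewrite (reindex s) /=; last exact: onW_bij.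
by apply: eq_bigr => i _; exact: fper.
Qed.

Lemma sum_resid_shift q f t : (0 < q)%N -> mod_periodic q f ->
  \sum_(x : {ffun 'I_n -> 'I_q}) f (resid x) =
  \sum_(x : {ffun 'I_n -> 'I_q}) f (resid x \+ t).
Proof.
move=> q0 fper; apply: sum_residE => //; first by rewrite card_ffun !card_ord.
move=> x y h; apply: eqmodv_resid => i; have /eqz_modP := h i.
by rewrite /= opprD addrACA subrr addr0 => /eqz_modP.
Qed.

Lemma sum_resid_mul d m f : (0 < d)%N -> (0 < m)%N -> mod_periodic d f ->
  \sum_(x : {ffun 'I_n -> 'I_(d * m)}) f (resid x) =
  (\sum_(x : {ffun 'I_n -> 'I_d}) f (resid x)) *+ (m ^ n).
Proof.
move=> d0 m0 fper.
pose g (u : {ffun 'I_n -> 'I_d} * {ffun 'I_n -> 'I_m}) :=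
  resid u.1 \+ (fun i => d%:Z * resid u.2 i).
have fper' : mod_periodic (d * m)%N f.
  move=> x y h; apply: fper => i; apply/eqz_modP.
  by apply: dvdz_trans ((eqz_modP _ _ _).1 (h i)); rewrite PoszM dvdz_mulr.
rewrite (@sum_residE _ _ g) ?muln_gt0 ?d0 //; first last.
- move=> -[u v] [u' v'] h.
  have uu : u = u'.
    apply: eqmodv_resid => i; apply/eqz_modP; have /eqz_modP /= := h i.
    move=> /(dvdz_trans (dvdz_mulr m%:Z (dvdzz d%:Z))).
    by rewrite opprD addrACA -mulrBr rpredDr //; exact: dvdz_mulr.
  rewrite -uu in h *; congr (_, _); apply: eqmodv_resid => i; apply/eqz_modP.
  have /eqz_modP /= := h i; rewrite opprD addrACA subrr add0r -mulrBr PoszM.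
  by rewrite dvdz_mul2l // eqz_nat -lt0n.
- by rewrite card_prod !card_ffun !card_ord expnMn.
rewrite -(pair_bigA _ (fun u v => f (g (u, v)))) /= exchange_big /=.
rewrite (eq_bigr (fun=> \sum_(x : {ffun 'I_n -> 'I_d}) f (resid x))).
  by rewrite sumr_const card_ffun !card_ord.
move=> v _; apply: eq_bigr => u _; apply: fper => i; apply/eqz_modP.
by rewrite /g /= [_ + _ - _]addrAC subrr add0r dvdz_mulr.
Qed.

Lemma sum_resid_crt d m f : (0 < d)%N -> (0 < m)%N -> coprime d m ->
    mod_periodic (d * m)%N f ->
  \sum_(x : {ffun 'I_n -> 'I_(d * m)}) f (resid x) =
  \sum_(u : {ffun 'I_n -> 'I_d}) \sum_(v : {ffun 'I_n -> 'I_m})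
    f ((fun i => m%:Z * resid u i) \+ (fun i => d%:Z * resid v i)).
Proof.
move=> d0 m0 cop fper.
pose g (u : {ffun 'I_n -> 'I_d} * {ffun 'I_n -> 'I_m}) :=
  (fun i => m%:Z * resid u.1 i) \+ (fun i => d%:Z * resid u.2 i).
rewrite (@sum_residE _ _ g) ?muln_gt0 ?d0 //; first last.
- move=> -[u v] [u' v'] h; congr (_, _).
    apply: eqmodv_resid => i; apply/eqz_modP; have /eqz_modP /= := h i.
    move=> /(dvdz_trans (dvdz_mulr m%:Z (dvdzz d%:Z))).
    rewrite opprD addrACA -!mulrBr rpredDr; last exact: dvdz_mulr.
    by rewrite Gauss_dvdzr.
  apply: eqmodv_resid => i; apply/eqz_modP; have /eqz_modP /= := h i.
  move=> /(dvdz_trans (dvdz_mull d%:Z (dvdzz m%:Z))).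
  rewrite opprD addrACA -!mulrBr rpredDl; last exact: dvdz_mulr.
  by rewrite Gauss_dvdzr // coprimez_sym.
- by rewrite card_prod !card_ffun !card_ord expnMn.
by rewrite -(pair_bigA _ (fun u v => f (g (u, v)))).
Qed.

End ResidueSums.

(** * The trilinear form of C *)

Section CubicForm.
Variables (n : nat) (c : coeffs n).
Hypothesis csym : symmetric_coeffs c.
Implicit Types x y z : 'I_n -> int.

(* [bform x y] is the vector M(x) y; see [bformMx]. *)
Definition bform x y : 'I_n -> int :=
  fun k => \sum_(i < n) \sum_(j < n) c i j k * x i * y j.

Definition tform x y z : int := \sum_k bform x y k * z k.

Lemma bformC x y k : bform x y k = bform y x k.
Proof.
rewrite /bform exchange_big; apply: eq_bigr => i _; apply: eq_bigr => j _.
by rewrite (csym i j k).1 mulrAC.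
Qed.

Lemma bformDl x y z k : bform (x \+ y) z k = bform x z k + bform y z k.
Proof.
rewrite /bform -big_split; apply: eq_bigr => i _; rewrite -big_split.
by apply: eq_bigr => j _ /=; ring.
Qed.

Lemma bformZl (a : int) x z k : bform (fun i => a * x i) z k = a * bform x z k.
Proof.
rewrite /bform mulr_sumr; apply: eq_bigr => i _; rewrite mulr_sumr.
by apply: eq_bigr => j _ /=; ring.
Qed.

Lemma bformDr x y z k : bform z (x \+ y) k = bform z x k + bform z y k.
Proof. by rewrite bformC bformDl bformC (bformC y). Qed.

Lemma bformZr (a : int) x z k : bform z (fun i => a * x i) k = a * bform z x k.
Proof. by rewrite bformC bformZl bformC. Qed.

Lemma bformMx x z k : bform x z k = \sum_j Mx c x k j * z j.
Proof.
rewrite /bform exchange_big; apply: eq_bigr => j _; rewrite mxE mulr_suml.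
by apply: eq_bigr => i _; rewrite (csym i j k).2.
Qed.

Lemma tformC x y z : tform x y z = tform y x z.
Proof. by apply: eq_bigr => k _; rewrite bformC. Qed.

Lemma tformCr x y z : tform x y z = tform x z y.
Proof.
rewrite /tform /bform.
under eq_bigr do rewrite mulr_suml.
under [RHS]eq_bigr do rewrite mulr_suml.
rewrite exchange_big [RHS]exchange_big; apply: eq_bigr => i _ /=.
under eq_bigr do rewrite mulr_suml.
under [RHS]eq_bigr do rewrite mulr_suml.
rewrite exchange_big; apply: eq_bigr => j _; apply: eq_bigr => k _.
by rewrite (csym i j k).2; ring.
Qed.

Lemma tformDr x y z w : tform x y (z \+ w) = tform x y z + tform x y w.
Proof. by rewrite /tform -big_split; apply: eq_bigr => k _; rewrite /= mulrDr. Qed.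

Lemma tformZr x y (a : int) z : tform x y (fun i => a * z i) = a * tform x y z.
Proof. by rewrite /tform mulr_sumr; apply: eq_bigr => k _; rewrite mulrCA. Qed.

Lemma tformDl x y z w : tform (x \+ y) z w = tform x z w + tform y z w.
Proof. by rewrite /tform -big_split; apply: eq_bigr => k _; rewrite bformDl mulrDl. Qed.

Lemma tformZl (a : int) x z w : tform (fun i => a * x i) z w = a * tform x z w.
Proof. by rewrite /tform mulr_sumr; apply: eq_bigr => k _; rewrite bformZl mulrA. Qed.

Lemma tformDm x y z w : tform z (x \+ y) w = tform z x w + tform z y w.
Proof. by rewrite tformC tformDl tformC (tformC y). Qed.

Lemma tformZm (a : int) x z w : tform z (fun i => a * x i) w = a * tform z x w.
Proof. by rewrite tformC tformZl tformC. Qed.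

Lemma cubicE x : cubic c x = tform x x x.
Proof.
rewrite /cubic /tform /bform.
under [RHS]eq_bigr do rewrite mulr_suml.
rewrite [RHS]exchange_big; apply: eq_bigr => i _ /=.
under [RHS]eq_bigr do rewrite mulr_suml.
by rewrite exchange_big.
Qed.

Lemma cubicD x y :
  cubic c (x \+ y) =
  cubic c x + 3 * tform x x y + 3 * tform y y x + cubic c y.
Proof.
rewrite !cubicE !(tformDl, tformDm, tformDr).
rewrite (tformCr x y x) (tformC y x x) (tformCr x y x) (tformCr y x y) (tformC x y y).
by rewrite (tformCr y x y); ring.
Qed.

Lemma cubicZ (a : int) x : cubic c (fun i => a * x i) = a ^+ 3 * cubic c x.
Proof. by rewrite !cubicE tformZl tformZm tformZr; ring. Qed.

Lemma cubic_modz (q : nat) : 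
  mod_periodic q (fun x => (cubic c x %% q)%Z).
Proof.
apply: mod_periodicP => x t; apply/eqz_modP.
rewrite cubicD cubicZ tformZr tformZl tformZm; apply/dvdzP.
exists (3 * tform x x t + 3 * (q%:Z * tform t t x) + q%:Z ^+ 2 * cubic c t).
by ring.
Qed.

Lemma bform_diag_modz (q : nat) k : mod_periodic q (fun x => (bform x x k %% q)%Z).
Proof.
apply: mod_periodicP => y t; apply/eqz_modP.
rewrite !(bformDr, bformDl, bformZr, bformZl); apply/dvdzP.
exists (bform y t k + bform t y k + q%:Z * bform t t k).
by ring.
Qed.

End CubicForm.

(** * Exponential sums *)

Section Characters.
Variable R : realType.
Implicit Types (z : R[i]) (q : nat).

Lemma normc_ge0 z : 0 <= normc z.
Proof. by case: z => a b; rewrite sqrtr_ge0. Qed.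

Lemma normc_sum (I : finType) (F : I -> R[i]) :
  normc (\sum_i F i) <= \sum_i normc (F i).
Proof.
apply: (big_ind2 (fun x y => normc x <= y)) => //; first by rewrite normc0.
by move=> x1 x2 y1 y2 h1 h2; exact: le_trans (le_normcD _ _) (lerD h1 h2).
Qed.

Lemma sqr_normc z : (normc z ^+ 2)%:C%C = z * (z^*)%C.
Proof.
case: z => a b /=; rewrite sqr_sqrtr ?addr_ge0 ?sqr_ge0 //.
by apply/eqP; rewrite eq_complex /=; apply/andP; split; apply/eqP; ring.
Qed.

Lemma normc_realc (x : R) : 0 <= x -> normc x%:C%C = x.
Proof. by move=> x0 /=; rewrite expr0n addr0 sqrtr_sqr ger0_norm. Qed.

Lemma normc_nat (m : nat) : normc (m%:R : R[i]) = m%:R.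
Proof. by rewrite -(rmorph_nat (real_complex R)) normc_realc. Qed.

(** The character e(m / q), with the same cosine and sine arguments as [S_re] and [S_im]. At [q = 0]
    it is constantly 1, since the inverse of 0 is 0. *)
Definition ech q (m : int) : R[i] :=
  Complex (cos (2 * pi * (m%:~R / q%:R))) (sin (2 * pi * (m%:~R / q%:R))).

Lemma echD q a b : ech q (a + b) = ech q a * ech q b.
Proof.
rewrite /ech; set t := 2 * pi; rewrite intrD mulrDl [t * _]mulrDr cosD sinD.
by apply/eqP; rewrite eq_complex /=; apply/andP; split; apply/eqP; ring.
Qed.

Lemma ech0 q : ech q 0 = 1.
Proof. by rewrite /ech mul0r mulr0 cos0 sin0. Qed.

Lemma conjc_ech q m : ((ech q m)^*)%C = ech q (- m).
Proof. by rewrite /ech /= intrN mulNr mulrN cosN sinN. Qed.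

Lemma normc_ech q m : normc (ech q m) = 1.
Proof. by rewrite /ech /= cos2Dsin2 sqrtr1. Qed.

Lemma ech_dvd q m : (q %| m)%Z -> ech q m = 1.
Proof.
have [->|q0] := eqVneq q 0%N.
  by rewrite /ech invr0 !mulr0 cos0 sin0.
have q0R : q%:R != 0 :> R by rewrite pnatr_eq0.
have natcase (k : nat) : ech q (k%:Z * q%:Z) = 1.
  rewrite /ech intrM mulfK // mulr_natl -[X in cos X]add0r -[X in sin X]add0r mulr_natr.
  rewrite (periodicn (@cosD2pi R)) (periodicn (@sinD2pi R)).
  by rewrite cos0 sin0.
case/dvdzP => k ->; case: (intP k) => [|{}k|{}k].
- by rewrite mul0r ech0.
- exact: natcase.
by rewrite mulNr -conjc_ech natcase conjc1.
Qed.

Lemma ech_modz q a b : (a = b %[mod q])%Z -> ech q a = ech q b.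
Proof.
move=> /eqz_modP ab.
by rewrite -[a](subrK b) echD (ech_dvd ab) mul1r.
Qed.

(** With r the residue of m and t = pi r / q, the equality cos (2 t) = 1 would force sin t = 0,
    whereas 0 < t < pi. *)
Lemma ech_neq1 q m : (0 < q)%N -> ~~ (q %| m)%Z -> ech q m != 1.
Proof.
move=> q0 qm.
have -> : ech q m = ech q (m %% q)%Z by apply: ech_modz; rewrite modz_mod.
have qZ : q%:Z != 0 by rewrite eqz_nat -lt0n.
have r0 : 0 < (m %% q)%Z.
  rewrite lt_neqAle modz_ge0 // andbT eq_sym.
  by apply: contra qm => /eqP h; apply/dvdz_mod0P.
have rq : (m %% q)%Z < q%:Z by rewrite ltz_pmod.
move: r0 rq; set r := (m %% q)%Z => r0 rq.
apply/negP => /eqP [+ _].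
have q0R : 0 < q%:R :> R by rewrite ltr0n.
have -> : 2 * pi * (r%:~R / q%:R) = (pi * (r%:~R / q%:R)) *+ 2 :> R.
  by rewrite -mulrA mulr_natl.
rewrite cos_mulr2n => h.
have : 0 < sin (pi * (r%:~R / q%:R) : R).
  apply: sin_gt0_pi; rewrite mulr_gt0 ?pi_gt0 ?divr_gt0 ?ltr0z //=.
  rewrite -[X in _ < X]mulr1 ltr_pM2l ?pi_gt0 // ltr_pdivrMr // mul1r.
  by rewrite -[q%:R]/(q%:Z%:~R) ltr_int.
have := cos2Dsin2 (pi * (r%:~R / q%:R) : R).
set C := cos _ in h *; set S := sin _ => h2 S0.
have S2 : 0 < S ^+ 2 by rewrite exprn_gt0.
by move: h h2 S2; lra.
Qed.

Lemma ech_scale Q d m : (0 < Q)%N -> ech (Q * d) (Q%:Z * m) = ech d m.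
Proof.
move=> Q0; have Q0R : Q%:R != 0 :> R by rewrite pnatr_eq0 -lt0n.
rewrite /ech intrM natrM; have -> // : Q%:Z%:~R * m%:~R / (Q%:R * d%:R) = m%:~R / d%:R :> R.
have [->|d0] := eqVneq d 0%N; first by rewrite mulr0 invr0 !mulr0.
by rewrite -[Q%:Z%:~R]/(Q%:R : R) -mulf_div divff // mul1r.
Qed.

End Characters.

Definition dvdv n (q : nat) (l : 'I_n -> int) : bool := [forall k, (q %| l k)%Z].

Section ExponentialSums.
Variables (R : realType) (n : nat) (c : coeffs n).
Hypothesis csym : symmetric_coeffs c.
Local Notation ech := (@ech R).

(** Orthogonality: if [q] does not divide [l k], translating x by the k-th unit vector multiplies
    the sum by [ech q (l k)], which is not 1. *)
Lemma sum_ech_linear q (l : 'I_n -> int) : (0 < q)%N ->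
  \sum_(x : {ffun 'I_n -> 'I_q}) ech q (\sum_k l k * resid x k) =
  if dvdv q l then (q ^ n)%:R else 0.
Proof.
move=> q0; case: ifPn => [/forallP ql|].
  rewrite (eq_bigr (fun=> 1)) ?sumr_const ?card_ffun ?card_ord // => x _.
  by apply: ech_dvd; apply: rpred_sum => k _; rewrite dvdz_mulr.
rewrite negb_forall => /existsP [k qk].
set S := LHS.
have : S = ech q (l k) * S.
  rewrite {1}/S (sum_resid_shift (fun i => (i == k)%:Z) q0
    (f := fun x => ech q (\sum_k l k * x k))); last first.
    apply: mod_periodicP => x t; apply: ech_modz; apply/eqz_modP.
    rewrite -sumrB; apply: rpred_sum => i _ /=.
    by rewrite mulrDr addrC addKr mulrCA dvdz_mulr.
  rewrite mulr_sumr; apply: eq_bigr => x _; rewrite -echD; congr ech.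
  under eq_bigr do rewrite /= mulrDr.
  rewrite big_split /= addrC; congr (_ + _).
  rewrite (bigD1 k) //= eqxx mulr1 big1 ?addr0 // => i /negbTE ->.
  by rewrite mulr0.
move=> /eqP; rewrite -subr_eq0 -{1}[S]mul1r -mulrBl mulf_eq0 subr_eq0 eq_sym.
by rewrite (negbTE (ech_neq1 R q0 qk)) => /eqP.
Qed.

Definition Ssum (q a : nat) : R[i] :=
  \sum_(x : {ffun 'I_n -> 'I_q}) ech q (a%:Z * cubic c (resid x)).

Lemma S_absE q a : S_abs R c q a = normc (Ssum q a).
Proof.
rewrite /S_abs /Ssum; set s := \sum_x _.
suff -> : s = Complex (S_re R c q a) (S_im R c q a) by [].
rewrite /s /S_re /S_im; apply: (big_rec3 (fun x y (z : R[i]) => z = Complex x y)) => //.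
by move=> x y1 y2 y3 _ ->.
Qed.

Lemma ech_cubic_periodic q a :
  mod_periodic q (fun x : 'I_n -> int => ech q (a%:Z * cubic c x)).
Proof.
move=> x y xy; apply: ech_modz.
by rewrite -modzMmr (cubic_modz csym xy) modzMmr.
Qed.

(** Expand the square as a double sum over x and y, and put y = x + h. The phase is general because
    the identity is applied to the cubic phase and then again to its differences. *)
Lemma autocorrelation q (psi : ('I_n -> int) -> int) : (0 < q)%N ->
    mod_periodic q (fun x => ech q (psi x)) ->
  (normc (\sum_(x : {ffun 'I_n -> 'I_q}) ech q (psi (resid x))) ^+ 2)%:C%C =
  \sum_(h : {ffun 'I_n -> 'I_q}) \sum_(x : {ffun 'I_n -> 'I_q})
    ech q (psi (resid x \+ resid h) - psi (resid x)).
Proof.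
move=> q0 per; rewrite sqr_normc rmorph_sum mulr_sumr exchange_big /=.
apply: eq_bigr => x _; rewrite mulr_suml.
rewrite (sum_resid_shift (resid x) q0
   (f := fun y => ech q (psi y) * ((ech q (psi (resid x)))^*)%C)).
  apply: eq_bigr => h _; rewrite conjc_ech -echD; congr (ech q (psi _ - _)).
  by apply/funext => i /=; rewrite addrC.
by move=> u v uv; rewrite (per _ _ uv).
Qed.

Definition Zcount q (h : 'I_n -> int) : nat :=
  #|[set y : {ffun 'I_n -> 'I_q} | dvdv q (fun k => 6 * bform c h (resid y) k)]|.

Lemma diff_cubic x h :
  cubic c (x \+ h) - cubic c x = 3 * tform c x x h + 3 * tform c h h x + cubic c h.
Proof. by rewrite cubicD //; ring. Qed.

(** The second difference of the cubic phase is affine in x with linear part 6 B(h, y), which makes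
    orthogonality applicable to the sum over x. *)
Lemma diff2_cubic x y h :
  (cubic c (x \+ y \+ h) - cubic c (x \+ y)) - (cubic c (x \+ h) - cubic c x) =
  \sum_k 6 * bform c h y k * x k + (3 * tform c y y h + 3 * tform c h h y).
Proof.
rewrite !diff_cubic.
have -> : \sum_k 6 * bform c h y k * x k = 6 * tform c h y x.
  by rewrite /tform mulr_sumr; apply: eq_bigr => k _; rewrite mulrA.
rewrite !tformDl // !tformDm // !tformDr.
rewrite (tformC csym y x h) (tformCr csym x y h) (tformC csym x h y) (tformCr csym h x y).
by ring.
Qed.

Lemma dvdv_coprime (q : nat) (a : int) (l : 'I_n -> int) : coprimez q a ->
  dvdv q (fun k => a * l k) = dvdv q l.
Proof. by move=> qa; apply: eq_forallb => k; rewrite Gauss_dvdzr. Qed.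

(** For each h, a second differencing in a direction y bounds the square of the inner sum by [q ^ n]
    times the number of y with q | 6 B(h, y); all other y contribute zero by [sum_ech_linear]. *)
Lemma weyl_step q a : (0 < q)%N -> coprime a q ->
  normc (Ssum q a) ^+ 2 <=
  \sum_(h : {ffun 'I_n -> 'I_q}) Num.sqrt ((q ^ n * Zcount q (resid h))%:R : R).
Proof.
move=> q0 aq.
have S2 := autocorrelation q0 (@ech_cubic_periodic q a).
rewrite -[X in X <= _]normc_realc ?exprn_ge0 ?normc_ge0 // /Ssum S2.
apply: le_trans (normc_sum _) _; apply: ler_sum => h _.
rewrite -[X in X <= _]ger0_norm ?normc_ge0 // -sqrtr_sqr ler_sqrt ?ler0n //.
have per : mod_periodic q
    (fun x => ech q (a%:Z * cubic c (x \+ resid h) - a%:Z * cubic c x)).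
  move=> x y xy; rewrite !echD -!conjc_ech (ech_cubic_periodic _ xy).
  rewrite (@ech_cubic_periodic _ _ (x \+ resid h) (y \+ resid h)) // => i.
  by rewrite /= -modzDml xy modzDml.
have G2 := autocorrelation q0 per.
rewrite -[X in X <= _]normc_realc ?exprn_ge0 ?normc_ge0 // G2.
apply: le_trans (normc_sum _) _.
rewrite mulnC natrM /Zcount -sum1_card natr_sum mulr_suml.
rewrite [X in _ <= X]big_mkcond /=.
apply: ler_sum => y _.
pose l k := a%:Z * (6 * bform c (resid h) (resid y) k).
pose K := a%:Z * (3 * tform c (resid y) (resid y) (resid h)
                  + 3 * tform c (resid h) (resid h) (resid y)).
rewrite (eq_bigr (fun x => ech q K * ech q (\sum_k l k * resid x k))).
  rewrite -mulr_sumr normcM normc_ech mul1r sum_ech_linear // inE.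
  rewrite /l dvdv_coprime; last by rewrite coprimezE /= coprime_sym.
  by case: ifP; rewrite ?normc_nat ?mul1r // normc0.
move=> x _; rewrite -echD; congr ech.
rewrite -!mulrBr diff2_cubic mulrDr /K [RHS]addrC; congr (_ + _).
by rewrite mulr_sumr; apply: eq_bigr => k _; rewrite /l !mulrA.
Qed.

(* Translating x by Q z multiplies its term by e(a z . grad C(x) / d), as d | Q;
   averaging over z mod d leaves only the x with d | grad C(x) = 3 B(x, x). *)
Lemma Ssum_critical Q d a : (0 < Q)%N -> (0 < d)%N -> (d %| Q)%N -> coprime a d ->
  normc (Ssum (Q * d) a) <=
  #|[set x : {ffun 'I_n -> 'I_(Q * d)} |
      dvdv d (fun k => 3 * bform c (resid x) (resid x) k)]|%:R.
Proof.
move=> Q0 d0 dQ ad.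
have qd0 : (0 < Q * d)%N by rewrite muln_gt0 Q0.
have dn0 : 0 < (d ^ n)%:R :> R by rewrite ltr0n expn_gt0 d0.
rewrite -(ler_pM2l dn0) -[X in X * normc _]normc_nat -normcM.
have -> : (d ^ n)%:R * Ssum (Q * d) a =
  \sum_(x : {ffun 'I_n -> 'I_(Q * d)}) ech (Q * d) (a%:Z * cubic c (resid x)) *
   if dvdv d (fun k => 3 * bform c (resid x) (resid x) k) then (d ^ n)%:R else 0.
  transitivity (\sum_(z : {ffun 'I_n -> 'I_d}) Ssum (Q * d) a).
    by rewrite sumr_const card_ffun !card_ord mulr_natl.
  transitivity (\sum_(z : {ffun 'I_n -> 'I_d}) \sum_(x : {ffun 'I_n -> 'I_(Q * d)})
     ech (Q * d) (a%:Z * cubic c (resid x \+ (fun i => Q%:Z * resid z i)))).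
    apply: eq_bigr => z _.
    exact: sum_resid_shift _ _ (@ech_cubic_periodic (Q * d) a).
  rewrite exchange_big; apply: eq_bigr => x _ /=.
  have acop : coprimez d a by rewrite coprimezE /= coprime_sym.
  rewrite -(dvdv_coprime _ acop) -sum_ech_linear // mulr_sumr.
  apply: eq_bigr => z _; rewrite -(ech_scale R d (\sum_k _) Q0) -echD; apply: ech_modz.
  rewrite cubicD // cubicZ // tformZr tformZl // tformZm //.
  (* The terms of degree at least 2 in z carry the factor [Q ^ 2], a multiple of [Q * d]. *)
  have [m mQ] := dvdnP dQ.
  apply/eqz_modP/dvdzP; rewrite PoszM.
  exists (a%:Z * m%:Z * (3 * tform c (resid z) (resid z) (resid x) + Q%:Z * cubic c (resid z))).
  have -> : \sum_k a%:Z * (3 * bform c (resid x) (resid x) k) * resid z k =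
    a%:Z * (3 * tform c (resid x) (resid x) (resid z)).
    by rewrite /tform !mulr_sumr; apply: eq_bigr => k _; ring.
  have E : Q%:Z = m%:Z * d%:Z by rewrite mQ PoszM.
  transitivity (a%:Z * (m%:Z * d%:Z) * (3 * tform c (resid z) (resid z) (resid x)
    + Q%:Z * cubic c (resid z)) * Q%:Z); last by ring.
  by rewrite -E; ring.
apply: le_trans (normc_sum _) _.
rewrite -sum1_card natr_sum mulr_sumr [X in _ <= X]big_mkcond /=.
apply: ler_sum => x _.
rewrite normcM normc_ech mul1r inE.
by case: ifP; rewrite ?normc_nat ?mulr1 // normc0.
Qed.

Lemma Ssum_mod q a : Ssum q (a %% q) = Ssum q a.
Proof.
apply: eq_bigr => x _; apply: ech_modz.
by rewrite -modz_nat modzMml.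
Qed.

(** Write x = q2 u + q1 v. The mixed terms of C(x) are multiples of q1 q2, and q2^3 C(u) / (q1 q2) =
    q2^2 C(u) / q1, whence the new numerators. *)
Lemma Ssum_mul q1 q2 a : (0 < q1)%N -> (0 < q2)%N -> coprime q1 q2 ->
  Ssum (q1 * q2) a = Ssum q1 (a * q2 ^ 2) * Ssum q2 (a * q1 ^ 2).
Proof.
move=> q10 q20 cop.
have perq := @ech_cubic_periodic (q1 * q2) a.
rewrite /Ssum (sum_resid_crt q10 q20 cop perq) mulr_suml; apply: eq_bigr => u _.
rewrite mulr_sumr; apply: eq_bigr => v _.
rewrite -(ech_scale R q1 (_ * cubic c (resid u)) q20) (mulnC q2).
rewrite -(ech_scale R q2 (_ * cubic c (resid v)) q10) -echD.
apply: ech_modz; apply/eqz_modP.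
rewrite cubicD // !cubicZ // !(tformZl, tformZm, tformZr) // PoszM.
rewrite -!mulnn !PoszM; apply/dvdzP.
exists (a%:Z * (3 * (q2%:Z * tform c (resid u) (resid u) (resid v))
   + 3 * (q1%:Z * tform c (resid v) (resid v) (resid u)))).
by ring.
Qed.

Lemma Ssum_le q a : normc (Ssum q a) <= (q ^ n)%:R.
Proof.
apply: le_trans (normc_sum _) _.
rewrite (eq_bigr (fun=> 1)) => [|x _]; last exact: normc_ech.
by rewrite sumr_const card_ffun !card_ord.
Qed.

End ExponentialSums.

(** * Counting solutions of B(h, y) = 0 *)

Section KernelCount.

(** The columns of [K] span the kernel of [A]. All rows of [K] are combinations of a maximal
    independent set of rows, and [f] lists the positions of that set. *)
Lemma kernel_coordinates (F : fieldType) n (A : 'M[F]_n) :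
  exists f : 'I_(n - \rank A) -> 'I_n, forall v : 'I_n -> F,
    (forall j, \sum_k A j k * v k = 0) -> (forall i, v (f i) = 0) ->
    forall k, v k = 0.
Proof.
pose K := (kermx A^T)^T.
have <- : \rank K = (n - \rank A)%N by rewrite mxrank_tr mxrank_ker mxrank_tr.
exists (maxrankfun K) => v Av vf k.
pose u : 'rV_n := \row_i v i.
have /sub_kermxP/submxP [w uw] : u *m A^T = 0.
  apply/rowP => j; rewrite !mxE -[RHS](Av j).
  by apply: eq_bigr => i _; rewrite !mxE mulrC.
have KwE : K *m w^T = u^T by rewrite uw trmx_mul.
have /submxP [X KX] : (K <= rowsub (maxrankfun K) K)%MS by rewrite eq_maxrowsub.
have : u^T = 0.
  rewrite -KwE {1}KX -mulmxA mul_rowsub_mx KwE.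
  suff -> : rowsub (maxrankfun K) u^T = 0 by rewrite mulmx0.
  by apply/matrixP => i j; rewrite !mxE vf.
by move/matrixP => /(_ k 0); rewrite !mxE.
Qed.

(** Two elements of [X] that agree in the coordinates given by [kernel_coordinates] coincide. Only
    differences enter, so inhomogeneous systems are covered; [g] embeds the coordinate range into
    the field, which will be ['F_p] or [rat]. *)
Lemma card_affine_solutions (F : fieldType) n m (A : 'M[F]_n) (g : 'I_m -> F)
    (X : {set {ffun 'I_n -> 'I_m}}) :
    injective g ->
    (forall x y, x \in X -> y \in X ->
       forall j, \sum_k A j k * (g (x k) - g (y k)) = 0) ->
  (#|X| <= m ^ (n - \rank A))%N.
Proof.
move=> ginj solX; have [f fP] := kernel_coordinates A.
pose h (x : {ffun 'I_n -> 'I_m}) : {ffun 'I_(n - \rank A) -> 'I_m} :=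
  [ffun i => x (f i)].
have -> : (m ^ (n - \rank A))%N = #|{: {ffun 'I_(n - \rank A) -> 'I_m}}|.
  by rewrite card_ffun !card_ord.
rewrite -(card_in_imset (f := h)) ?max_card // => x y xX yX hxy.
apply/ffunP => k; apply: ginj; apply/eqP; rewrite -subr_eq0; apply/eqP.
move: k; apply: fP (solX _ _ xX yX) _ => i.
by move/ffunP: hxy => /(_ i); rewrite !ffunE => ->; rewrite subrr.
Qed.

End KernelCount.

(** * Solutions modulo p and in boxes, counted by rank *)

Section RankCounts.
Variables (n : nat) (c : coeffs n).
Hypothesis csym : symmetric_coeffs c.

Lemma dvdz_Fp (p : nat) (m : int) : prime p -> (p %| m)%Z = (m%:~R == 0 :> 'F_p).
Proof. by move=> pp; rewrite (dvdz_pcharf (pchar_Fp pp)). Qed.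

Lemma card_bform_mod (p : nat) (d : int) (h w : 'I_n -> int) : prime p -> coprimez p d ->
  (#|[set z : {ffun 'I_n -> 'I_p} |
      dvdv p (fun k => d * bform c h (resid z) k + w k)%R]| <= p ^ (n - rp c p h))%N.
Proof.
move=> pp pd; apply: (card_affine_solutions (g := fun i => (i : nat)%:Z%:~R : 'F_p)).
  move=> i j /eqP; rewrite -subr_eq0 -intrB -dvdz_Fp // => /eqz_modP.
  by rewrite !modz_nat !modn_small // => -[] /val_inj.
move=> x y; rewrite !inE => /forallP hx /forallP hy j; apply/eqP.
have : (p %| bform c h (resid x) j - bform c h (resid y) j)%Z.
  rewrite -(Gauss_dvdzr _ pd) mulrBr.
  have -> : d * bform c h (resid x) j - d * bform c h (resid y) j =
    (d * bform c h (resid x) j + w j) - (d * bform c h (resid y) j + w j) by ring.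
  by rewrite rpredB ?hx ?hy.
rewrite dvdz_Fp // => /eqP h0; apply/eqP; rewrite -[RHS]h0 !bformMx // -sumrB.
rewrite rmorph_sum; apply: eq_bigr => k _.
by rewrite mxE -mulrBr -intrB -intrM.
Qed.

Lemma card_bform_box N (h : 'I_n -> int) :
  (#|[set z : {ffun 'I_n -> 'I_(2 * N).+1} |
      [forall k, bform c h (box_pt z) k == 0%R]]| <= (2 * N).+1 ^ (n - rQ c h))%N.
Proof.
apply: (card_affine_solutions (g := fun i => ((i : nat)%:Z - N%:Z)%:~R : rat)).
  by move=> i j /eqP; rewrite eqr_int => /eqP /addIr [] /val_inj.
move=> x y; rewrite !inE => /forallP hx /forallP hy j.
rewrite (eq_bigr (fun k => (Mx c h j k * box_pt x k - Mx c h j k * box_pt y k)%:~R)).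
  by rewrite -rmorph_sum sumrB -!bformMx // (eqP (hx j)) (eqP (hy j)) subrr.
by move=> k _; rewrite mxE /box_pt -mulrBr intrM !intrB.
Qed.

(* Pigeonhole: two points of [L] in the same box of side N + 1 differ by a point
   of [L] in [-N, N]^n. *)
Lemma shrink q N (L : ('I_n -> int) -> bool) :
    (forall x y, L x -> L y -> L (fun i => x i - y i)) ->
  (#|[set x : {ffun 'I_n -> 'I_q} | L (resid x)]| <=
   (q %/ N.+1).+1 ^ n * #|[set v : {ffun 'I_n -> 'I_(2 * N).+1} | L (box_pt v)]|)%N.
Proof.
move=> Lsub.
(* [f x] is the index of the box of side [N.+1] containing x. *)
pose f (x : {ffun 'I_n -> 'I_q}) : {ffun 'I_n -> 'I_(q %/ N.+1).+1} :=
  [ffun i => inord (x i %/ N.+1)].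
rewrite -sum1_card (partition_big f predT) //=.
have -> : ((q %/ N.+1).+1 ^ n)%N = #|{: {ffun 'I_n -> 'I_(q %/ N.+1).+1}}|.
  by rewrite card_ffun !card_ord.
rewrite -sum_nat_const; apply: leq_sum => b _.
pose X := [set x | L (resid x) & f x == b].
have -> : (\sum_(i in [set x | L (resid x)] | f i == b) 1 = #|X|)%N.
  by rewrite -sum1_card; apply: eq_bigl => x; rewrite !inE.
have [[x0 x0X]|Xempty] := pselect (exists x, x \in X); last first.
  by rewrite (eq_card0 (A := X)) // => x; apply/negP => xX; apply: Xempty; exists x.
(* The difference from the fixed point [x0] of the box, shifted by [N] into [0, 2N] to match
   [box_pt]. *)
pose h (x : {ffun 'I_n -> 'I_q}) : {ffun 'I_n -> 'I_(2 * N).+1} :=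
  [ffun i => inord (x i + N - x0 i)].
have close x i : x \in X -> (x0 i <= x i + N /\ x i <= x0 i + N)%N.
  move: x0X; rewrite !inE => /andP[_ /eqP <-] /andP[_ /eqP /ffunP /(_ i)].
  rewrite !ffunE => /(congr1 val) /=.
  rewrite !inordK ?ltnS ?leq_div2r ?(ltnW (ltn_ord _)) // => e.
  rewrite [x i : nat](divn_eq _ N.+1) [x0 i : nat](divn_eq _ N.+1) e.
  have := ltn_pmod (x i) (ltn0Sn N); have := ltn_pmod (x0 i) (ltn0Sn N).
  by lia.
have hE x i : x \in X -> (h x i)%:Z = (x i)%:Z + N%:Z - (x0 i)%:Z.
  move=> xX; have [h1 h2] := close x i xX.
  rewrite ffunE inordK -?subzn ?PoszD // ltnS leq_subLR mul2n -addnn addnA.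
  by rewrite leq_add2r.
rewrite -(card_in_imset (f := h)).
  apply: subset_leq_card; apply/fintype.subsetP => _ /imsetP [x xX ->]; rewrite inE.
  have -> : box_pt (h x) = (fun i => resid x i - resid x0 i).
    by apply/funext => i; rewrite /box_pt hE // /resid; ring.
  by move: xX x0X; rewrite !inE => /andP[Lx _] /andP[Lx0 _]; exact: Lsub.
move=> x y xX yX hxy; apply/ffunP => i; apply/val_inj => /=.
have := hE x i xX; rewrite hxy hE // => /addIr /addIr [].
by move=> ->.
Qed.

Definition height6 : nat := (6 * \sum_i \sum_j \sum_k `|c i j k|)%N.

Lemma bform_le N x y k :
    (forall i, `|x i| <= N%:Z) -> (forall i, `|y i| <= N%:Z) ->
  `|6 * bform c x y k| <= height6%:Z * N%:Z ^+ 2.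
Proof.
move=> xN yN; rewrite normrM /height6 PoszM -mulrA ler_pM2l //.
apply: le_trans (ler_norm_sum _ _ _) _.
rewrite (big_morph Posz PoszD (erefl 0%:Z)) mulr_suml; apply: ler_sum => i _.
apply: le_trans (ler_norm_sum _ _ _) _.
rewrite (big_morph Posz PoszD (erefl 0%:Z)) mulr_suml; apply: ler_sum => j _.
rewrite (bigD1 k) //= PoszD mulrDl abszE.
apply: le_trans (_ : `|c i j k| * N%:Z ^+ 2 <= _); last first.
  by rewrite lerDl mulr_ge0 // exprn_ge0.
by rewrite !normrM -mulrA ler_wpM2l // expr2 ler_pM.
Qed.

Lemma norm_box_pt N (v : {ffun 'I_n -> 'I_(2 * N).+1}) i : `|box_pt v i| <= N%:Z.
Proof. by rewrite /box_pt; have := ltn_ord (v i); lia. Qed.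

(** [shrink] is applied to y for fixed h and then, after exchanging the sums, to h for fixed y. Once
    both lie in the box of radius N, |6 B(h, y)| < q, so divisibility by q means B(h, y) = 0 and
    [card_bform_box] applies. *)
Lemma sum_Zcount_le q N : (0 < q)%N -> (height6 * N ^ 2 < q)%N ->
  (\sum_(h : {ffun 'I_n -> 'I_q}) Zcount c q (resid h) <=
   (q %/ N.+1).+1 ^ (2 * n) *
   \sum_(w : {ffun 'I_n -> 'I_(2 * N).+1}) (2 * N).+1 ^ (n - rQ c (box_pt w)))%N.
Proof.
move=> q0 Nq; set m := (q %/ N.+1).+1.
pose L x y := dvdv q (fun k => 6 * bform c x y k).
have Lr x y z : L x y -> L x z -> L x (fun i => y i - z i).
  move=> /forallP xy /forallP xz; apply/forallP => k.
  have -> : (fun i => y i - z i) = y \+ (fun i => -1 * z i).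
    by apply/funext => i /=; rewrite mulN1r.
  by rewrite bformDr // bformZr // mulN1r mulrBr rpredB ?xy ?xz.
have Lsym x y : L x y = L y x.
  by apply: eq_forallb => k; rewrite bformC.
have step1 : (\sum_(h : {ffun 'I_n -> 'I_q}) Zcount c q (resid h) <=
   m ^ n * \sum_(v : {ffun 'I_n -> 'I_(2 * N).+1})
     #|[set h : {ffun 'I_n -> 'I_q} | L (resid h) (box_pt v)]|)%N.
  apply: leq_trans (_ : \sum_(h : {ffun 'I_n -> 'I_q}) m ^ n *
      #|[set v : {ffun 'I_n -> 'I_(2 * N).+1} | L (resid h) (box_pt v)]| <= _)%N.
    by apply: leq_sum => h _; apply: (@shrink q N (L (resid h))); exact: Lr.
  rewrite -big_distrr /= leq_mul2l; apply/orP; right.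
  under eq_bigr do rewrite -sum1dep_card big_mkcond.
  by rewrite exchange_big leq_sum // => v _; rewrite -sum1dep_card [X in (_ <= X)%N]big_mkcond.
apply: leq_trans step1 _; rewrite [(2 * n)%N]mul2n -addnn expnD -mulnA leq_mul2l.
apply/orP; right; rewrite big_distrr /= leq_sum // => v _.
apply: leq_trans (_ : m ^ n * #|[set w : {ffun 'I_n -> 'I_(2 * N).+1} |
   L (box_pt w) (box_pt v)]| <= _)%N.
  apply: (@shrink q N (fun x => L x (box_pt v))) => x y.
  by rewrite ![L _ (box_pt v)]Lsym; exact: Lr.
rewrite leq_mul2l; apply/orP; right.
apply: leq_trans (card_bform_box N (box_pt v)).
suff sub : [set w | L (box_pt w) (box_pt v)] \subset
    [set z : {ffun 'I_n -> 'I_(2 * N).+1} | [forall k, bform c (box_pt v) (box_pt z) k == 0]].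
  exact: subset_leq_card sub.
apply/fintype.subsetP => w; rewrite !inE => /forallP Lw; apply/forallP => k.
have := Lw k; rewrite bformC //; set b := bform _ _ _ _ => qb.
have b_lt : (`|(6 * b)%R|%N < q)%N.
  rewrite -ltz_nat abszE; apply: le_lt_trans (bform_le _ (norm_box_pt v) (norm_box_pt w)) _.
  by rewrite -[_ ^+ 2]/((N ^ 2)%N%:Z) -PoszM ltz_nat.
have [//|b0] := eqVneq b 0.
move: qb; rewrite dvdzE => /(dvdn_leq _) q_le.
have /q_le : (0 < `|(6 * b)%R|)%N by rewrite absz_gt0 mulf_neq0.
by move=> /leq_ltn_trans /(_ b_lt); rewrite absz_nat ltnn.
Qed.

End RankCounts.

(** * Weyl's inequality *)

Section WeylBound.
Variable R : realType.

Lemma sqr_sum_le (I : finType) (F : I -> R) :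
  (\sum_i F i) ^+ 2 <= #|I|%:R * \sum_i F i ^+ 2.
Proof.
have -> : #|I|%:R * \sum_i F i ^+ 2 = \sum_i \sum_j (F i ^+ 2 + F j ^+ 2) / 2.
  set S := \sum_i F i ^+ 2.
  transitivity ((S *+ #|I| + S *+ #|I|) / 2); first by rewrite -mulr_natl; field.
  under [RHS]eq_bigr do rewrite -mulr_suml big_split /= sumr_const.
  by rewrite -mulr_suml big_split /= sumr_const sumrMnl.
rewrite expr2 mulr_suml; apply: ler_sum => i _; rewrite mulr_sumr.
apply: ler_sum => j _; rewrite -subr_ge0.
have -> : (F i ^+ 2 + F j ^+ 2) / 2 - F i * F j = (F i - F j) ^+ 2 / 2 by field.
by rewrite divr_ge0 ?sqr_ge0.
Qed.

(** N is about (q / H)^(1/2). The left inequality will imply the size condition of [sum_Zcount_le],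
    the right one that q / (N + 1) <= H (N + 1). *)
Lemma sqrt_bracket (H q : nat) : (0 < H)%N -> (0 < q)%N ->
  exists N, (H * N ^ 2 < q <= H * N.+1 ^ 2)%N.
Proof.
move=> H0 q0; have ex : exists N, (q <= H * N.+1 ^ 2)%N.
  by exists q; nia.
exists (ex_minn ex); case: ex_minnP => -[|N] hN minN; rewrite hN andbT.
  by rewrite muln0.
by rewrite ltnNge; apply/negP => /minN; rewrite ltnn.
Qed.

Lemma sum_partition_nat (I : finType) (f : I -> nat) (m : nat) (F : nat -> R) :
    (forall i, (f i < m)%N) ->
  \sum_i F (f i) = \sum_(r < m) #|[set i | f i == r]|%:R * F r.
Proof.
move=> fm; rewrite (partition_big (fun i => Ordinal (fm i)) predT) //=.
apply: eq_bigr => r _; rewrite -sum1dep_card natr_sum mulr_suml.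
apply: eq_big => [i|i /eqP <-]; last by rewrite mul1r.
by rewrite -val_eqE.
Qed.

Variables (n : nat) (c : coeffs n).
Hypothesis csym : symmetric_coeffs c.

(** Cauchy-Schwarz over h removes the square roots of [weyl_step]. *)
Lemma Ssum_pow4 q a : (0 < q)%N -> coprime a q ->
  normc (Ssum R c q a) ^+ 4 <=
  (q%:R ^+ n) ^+ 2 * (\sum_(h : {ffun 'I_n -> 'I_q}) Zcount c q (resid h))%:R.
Proof.
move=> q0 aq; have := weyl_step R csym q0 aq; set S := normc _ => S2.
have S4 : S ^+ 4 = (S ^+ 2) ^+ 2 by rewrite -exprM.
rewrite S4; apply: le_trans (_ : (\sum_(h : {ffun 'I_n -> 'I_q})
   Num.sqrt ((q ^ n * Zcount c q (resid h))%:R : R)) ^+ 2 <= _).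
  by rewrite lerXn2r // ?nnegrE ?exprn_ge0 ?normc_ge0 // sumr_ge0.
apply: le_trans (sqr_sum_le _) _.
rewrite card_ffun !card_ord natrX expr2 -mulrA ler_wpM2l ?exprn_ge0 //.
rewrite natr_sum mulr_sumr ler_sum // => h _.
by rewrite sqr_sqrtr ?ler0n // natrM natrX.
Qed.

Hypothesis dgc : davenport_geometric R c.

(** By the geometric condition there are O(N^(r + eps)) points of rank r, each of weight (2N + 1)^(n
    - r); thus every r contributes O(N^(n + eps)). *)
Lemma rank_weight_bound (eps : R) : 0 < eps ->
  exists2 K : R, 0 <= K & forall N, (0 < N)%N ->
  (\sum_(w : {ffun 'I_n -> 'I_(2 * N).+1}) (2 * N).+1 ^ (n - rQ c (box_pt w)))%:R
  <= K * N.+1%:R `^ (n%:R + eps).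
Proof.
move=> eps0.
have /(_ _)/cid-/all_sig [K KP] : forall r : 'I_n.+1, exists K : R, forall P : R,
    1 <= P -> (count_rank c P r)%:R <= K * P `^ (r%:R + eps).
  by move=> r; apply: dgc => //; rewrite -ltnS.
exists (\sum_(r < n.+1) `|K r| * 2 ^+ n) => [|N N0].
  by apply: sumr_ge0 => r _; rewrite mulr_ge0 // exprn_ge0.
rewrite natr_sum (sum_partition_nat (m := n.+1)
  (fun r => ((2 * N).+1 ^ (n - r))%:R)); last first.
  by move=> w; rewrite ltnS rank_leq_row.
rewrite mulr_suml; apply: ler_sum => r _.
have N1 : 1 <= N%:R :> R by rewrite ler1n.
have M0 : 0 < N.+1%:R :> R by rewrite ltr0n.
have -> : #|[set w : {ffun 'I_n -> 'I_(2 * N).+1} | rQ c (box_pt w) == r]| =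
   count_rank c (N%:R : R) r.
  rewrite /count_rank natrK; apply: eq_card => w; rewrite !inE.
  case: (rQ _ _ == r); rewrite ?andbF // andbT; apply/esym/forallP => i.
  by rewrite -[N%:R]/(N%:Z%:~R) ler_int norm_box_pt.
have hcount : (count_rank c (N%:R : R) r)%:R <= `|K r| * N.+1%:R `^ (r%:R + eps).
  apply: le_trans (KP r _ N1) _.
  apply: le_trans (_ : `|K r| * N%:R `^ (r%:R + eps) <= _).
    by rewrite ler_wpM2r ?powR_ge0 // ler_norm.
  rewrite ler_wpM2l // ge0_ler_powR ?nnegrE ?ler0n ?ler_nat //.
  by rewrite addr_ge0 // ltW.
have hpow : ((2 * N).+1 ^ (n - r))%:R <= 2 ^+ n * N.+1%:R ^+ (n - r) :> R.
  rewrite natrX; apply: le_trans (_ : (2 * N.+1%:R) ^+ (n - r) <= _).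
    by rewrite lerXn2r ?nnegrE ?ler0n ?mulr_ge0 // -natrM ler_nat mulnS.
  rewrite exprMn ler_wpM2r ?exprn_ge0 ?ler0n // ler_weXn2l ?ler1n ?leq_subr //.
apply: le_trans (ler_pM _ _ hcount hpow) _; rewrite ?ler0n //.
rewrite mulrACA ler_wpM2l ?mulr_ge0 ?exprn_ge0 //.
rewrite -powR_mulrn ?ler0n // -powRD; last by rewrite pnatr_eq0 implybT.
have -> // : r%:R + eps + (n - r)%:R = n%:R + eps :> R.
by rewrite natrB -1?ltnS //; ring.
Qed.

(** With N of order q^(1/2), the preceding counts give |S|^4 << q^(2n) (q / N)^(2n) N^(n + eps).
    Hence the fourth power of |S| / q^n is O(N^(-(n - eps))), that is O(q^(-(n - eps) / 2)). *)
Lemma weyl_bound (eps : R) : 0 < eps -> eps <= n%:R ->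
  exists2 K : R, 0 <= K & forall q a, (0 < q)%N -> coprime a q ->
    normc (Ssum R c q a) / q%:R ^+ n <= K * q%:R `^ (- ((n%:R - eps) / 8)).
Proof.
move=> eps0 epsn; have [K1 K10 hK1] := rank_weight_bound eps0.
pose s := n%:R - eps; have s0 : 0 <= s by rewrite subr_ge0.
pose H := (height6 c).+1; pose H' := H%:R : R.
have H1 : 1 <= H' by rewrite ler1n.
have H0 : 0 < H' by exact: lt_le_trans H1.
(* The summand 1 covers [N = 0], where only the trivial bound |S| <= q^n is used. *)
pose K2 := (8 * H') ^+ (2 * n) * K1 + 1.
have K20 : 1 <= K2 by rewrite lerDr mulr_ge0 // exprn_ge0 // mulr_ge0 // ltW.
pose K := K2 * H' `^ (s / 2).
have K_1 : 1 <= K.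
  rewrite -[1]mulr1 ler_pM // -[X in X <= _](powRr0 H') ler_powR //.
  by rewrite divr_ge0.
exists K => [|q a q0 aq]; first exact: le_trans K_1.
have qR0 : 0 < q%:R :> R by rewrite ltr0n.
set x := _ / _; have x0 : 0 <= x by rewrite divr_ge0 ?normc_ge0 ?exprn_ge0.
have x1 : x <= 1.
  by rewrite ler_pdivrMr ?exprn_gt0 // mul1r -natrX; exact: Ssum_le.
have [N /andP[HNq qHN]] := sqrt_bracket (ltn0Sn (height6 c)) q0.
pose M := N.+1%:R : R.
have M1 : 1 <= M by rewrite ler1n.
have M0 : 0 < M by exact: lt_le_trans M1.
have hx4 : x ^+ 4 <= K2 * M `^ (- s).
  have [N0|N0] := posnP N.
    have -> : M = 1 by rewrite /M N0.
    by rewrite powR1 mulr1; apply: le_trans K20; exact: exprn_ile1.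
  pose W := (\sum_(h : {ffun 'I_n -> 'I_q}) Zcount c q (resid h))%:R : R.
  have hx : x ^+ 4 <= W / (q%:R ^+ n) ^+ 2.
    rewrite /x expr_div_n ler_pdivrMr ?exprn_gt0 //.
    apply: le_trans (Ssum_pow4 q0 aq) _; rewrite -/W le_eqVlt; apply/orP; left.
    have u : q%:R ^+ n != 0 :> R by rewrite expf_neq0 // pnatr_eq0 -lt0n.
    by apply/eqP; field.
  have hW : W <= (2 * H' * M) ^+ (2 * n) * (K1 * M `^ (n%:R + eps)).
    have NH : (height6 c * N ^ 2 < q)%N.
      by apply: leq_ltn_trans HNq; rewrite leq_mul2r leqnSn orbT.
    have := sum_Zcount_le csym q0 NH; rewrite -(ler_nat R) natrM => hZ.
    apply: le_trans hZ _; apply: ler_pM; rewrite ?ler0n //; last exact: hK1.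
    rewrite natrX; apply: lerXn2r; rewrite ?nnegrE ?ler0n //.
      by rewrite !mulr_ge0 // ltW.
    rewrite /H' /M -!natrM ler_nat.
    apply: (@leq_trans (H * N.+1).+1); last by rewrite -mulnA mul2n -addnn -addn1 leq_add2l.
    rewrite ltnS; apply: leq_trans (leq_div2r _ qHN) _.
    by rewrite expnS expn1 mulnA mulnK.
  (* Since N >= 1, q > N^2 >= ((N + 1) / 2)^2. *)
  have hq : (M ^+ 2 / 4) ^+ (2 * n) <= (q%:R ^+ n) ^+ 2.
    rewrite -exprM mulnC; apply: lerXn2r; rewrite ?nnegrE ?ler0n //.
      by rewrite divr_ge0 // exprn_ge0 // ltW.
    apply: (@le_trans _ _ (N%:R ^+ 2)).
      rewrite ler_pdivrMr // /M -natr1.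
      by have : 1 <= N%:R :> R by [rewrite ler1n]; nra.
    by rewrite -natrX ler_nat; apply: leq_trans (ltnW HNq); rewrite leq_pmull.
  apply: le_trans hx _.
  apply: (@le_trans _ _ ((2 * H' * M) ^+ (2 * n) * (K1 * M `^ (n%:R + eps))
     / (M ^+ 2 / 4) ^+ (2 * n))).
    apply: ler_pM; rewrite ?invr_ge0 ?exprn_ge0 ?ler0n // lef_pV2 //.
      by rewrite posrE exprn_gt0 // exprn_gt0.
    by rewrite posrE exprn_gt0 // divr_gt0 // exprn_gt0.
  rewrite mulrAC -expr_div_n.
  have -> : 2 * H' * M / (M ^+ 2 / 4) = 8 * H' / M by field; rewrite gt_eqF.
  rewrite expr_div_n -!mulrA [_^-1 * _]mulrCA.
  have -> : (M ^+ (2 * n))^-1 * M `^ (n%:R + eps) = M `^ (- s).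
    rewrite -powR_invn ?ltW // -powRD; last by rewrite (gt_eqF M0) implybT.
    by congr powR; rewrite /s natrM; ring.
  rewrite mulrA ler_wpM2r ?powR_ge0 // lerDl //.
have hM : M `^ (- s) <= H' `^ (s / 2) * q%:R `^ (- (s / 2)).
  rewrite !powRN -[X in _ <= X]invrK invfM invrK mulrC.
  rewrite lef_pV2 ?posrE ?divr_gt0 ?powR_gt0 //.
  have -> : M `^ s = (M ^+ 2) `^ (s / 2).
    by rewrite -powR_mulrn ?ltW // -powRrM; congr powR; field.
  rewrite ler_pdivrMr ?powR_gt0 // -powRM ?exprn_ge0 ?(ltW M0) ?(ltW H0) //.
  apply: ge0_ler_powR; rewrite ?nnegrE ?ler0n ?divr_ge0 //.
    by rewrite mulr_ge0 ?exprn_ge0 // ltW.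
  by rewrite mulrC -natrX -natrM ler_nat.
have -> : q%:R `^ (- (s / 8)) = (q%:R `^ (- (s / 2))) `^ (4^-1).
  by rewrite -powRrM; congr powR; field.
set y := _ `^ (- (s / 2)) in hM *.
have y0 : 0 <= y by exact: powR_ge0.
have Ky0 : 0 <= K * y `^ 4^-1.
  by rewrite mulr_ge0 ?powR_ge0 // (le_trans ler01 K_1).
have y4 : (y `^ 4^-1) ^+ 4 = y.
  by rewrite -powR_mulrn ?powR_ge0 // -powRrM mulVf ?powRr1.
(* Fourth powers are compared; as [K] is at least 1, it is at most its own fourth power. *)
rewrite -(@ler_pXn2r _ 4) ?nnegrE // [X in _ <= X]exprMn y4.
apply: le_trans hx4 _; apply: (@le_trans _ _ (K * y)).
  by rewrite /K -mulrA ler_wpM2l // (le_trans ler01).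
by rewrite ler_wpM2r // ler_eXnr.
Qed.

End WeylBound.

(** * Densities of critical points modulo prime powers *)

Section PrimePowers.
Variables (R : realType) (n : nat) (c : coeffs n) (p : nat).
Hypothesis csym : symmetric_coeffs c.
Hypothesis p_pr : prime p.

Let p0 : (0 < p)%N := prime_gt0 p_pr.
Let pR0 : 0 < p%:R :> R. Proof. by rewrite ltr0n. Qed.

Lemma rp_mod : mod_periodic p (rp c p).
Proof.
move=> x y xy; congr (\rank _); apply/matrixP => j k; rewrite !mxE.
apply/eqP; rewrite -subr_eq0 -intrB -dvdz_Fp // -sumrB.
apply: rpred_sum => i _; rewrite -mulrBr dvdz_mull //; exact/eqz_modP.
Qed.

Lemma rpZ (a : int) x : rp c p x = 0%N -> rp c p (fun i => a * x i) = 0%N.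
Proof.
move=> /eqP; rewrite mxrank_eq0 => /eqP h; apply/eqP; rewrite mxrank_eq0.
apply/eqP/matrixP => j k; have /matrixP /(_ j k) := h; rewrite !mxE => h'.
have -> : \sum_i c i j k * (a * x i) = a * \sum_i c i j k * x i.
  by rewrite mulr_sumr; apply: eq_bigr => i _; rewrite mulrCA.
by rewrite intrM h' mulr0.
Qed.

Lemma rp0 x : (forall i, x i = 0) -> rp c p x = 0%N.
Proof.
move=> x0; apply/eqP; rewrite mxrank_eq0; apply/eqP/matrixP => j k.
by rewrite !mxE big1 // => i _; rewrite x0 mulr0.
Qed.

Definition rank_weight (x : 'I_n -> int) : R := p%:R^-1 ^+ rp c p x.

(** This is the D(p) of the introduction. *)
Definition rank_sum : R := \sum_(h : {ffun 'I_n -> 'I_p}) rank_weight (resid h).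

Lemma rank_weight_ge0 x : 0 <= rank_weight x.
Proof. by rewrite exprn_ge0 // invr_ge0 ler0n. Qed.

Lemma rank_weight_mod : mod_periodic p rank_weight.
Proof. by move=> x y xy; rewrite /rank_weight (rp_mod xy). Qed.

(** The vector h = 0 has rank 0. The bound allows D(p) to replace its square root and to absorb
    constants. *)
Lemma rank_sum_ge1 : 1 <= rank_sum.
Proof.
rewrite /rank_sum (bigD1 [ffun=> Ordinal p0]) //= /rank_weight rp0; last first.
  by move=> i; rewrite /resid ffunE.
by rewrite expr0 lerDl sumr_ge0 // => i _; exact: rank_weight_ge0.
Qed.

(* All multiples of u have rank 0 modulo p. *)
Lemma rank_sum_degenerate (u : 'I_n -> int) i :
  rp c p u = 0%N -> ~~ (p %| u i)%Z -> p%:R <= rank_sum.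
Proof.
move=> u0 pu.
pose s (t : 'I_p) := projT1 (cid (resid_surj (fun i => t%:Z * u i) p0)).
have sE t : eqmodv p (resid (s t)) (fun i => t%:Z * u i) :=
  projT2 (cid (resid_surj (fun i => t%:Z * u i) p0)).
have sinj : injective s.
  move=> t1 t2 e; apply/val_inj; have := sE t1 i.
  rewrite e sE => /eqz_modP; rewrite -mulrBl Gauss_dvdzl; last first.
    by rewrite coprimezE /= prime_coprime.
  by move=> /eqz_modP; rewrite !modz_nat !modn_small // => -[].
have -> : p%:R = \sum_(t < p) rank_weight (resid (s t)).
  rewrite (eq_bigr (fun=> 1)) ?sumr_const ?card_ord // => t _.
  by rewrite (rank_weight_mod (sE t)) /rank_weight rpZ.
apply: (ler_sum_inj (f := s) (F := fun h => rank_weight (resid h))) => //.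
  by move=> t1 t2 _ _; exact: sinj.
by move=> h _; exact: rank_weight_ge0.
Qed.

Lemma natr_expB r : (r <= n)%N -> (p ^ (n - r))%:R = p%:R ^+ n * p%:R^-1 ^+ r :> R.
Proof.
move=> rn; rewrite natrX -[in RHS](subnK rn) exprD -mulrA -exprMn divff ?gt_eqF //.
by rewrite expr1n mulr1.
Qed.

Definition mean q (f : ('I_n -> int) -> R) : R :=
  (\sum_(x : {ffun 'I_n -> 'I_q}) f (resid x)) / q%:R ^+ n.

Lemma mean_le q f g : (forall x, f x <= g x) -> mean q f <= mean q g.
Proof. by move=> fg; rewrite ler_wpM2r ?invr_ge0 ?exprn_ge0 // ler_sum. Qed.

Lemma mean_ge0 q f : (forall x, 0 <= f x) -> 0 <= mean q f.
Proof. by move=> f0; rewrite divr_ge0 ?exprn_ge0 // sumr_ge0. Qed.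

Lemma meanD q f g : mean q (fun x => f x + g x) = mean q f + mean q g.
Proof. by rewrite /mean big_split mulrDl. Qed.

Lemma meanZ q a f : mean q (fun x => a * f x) = a * mean q f.
Proof. by rewrite /mean -mulr_sumr mulrA. Qed.

Lemma mean_mod q f : (0 < q)%N -> (p %| q)%N -> mod_periodic p f ->
  mean q f = mean p f.
Proof.
move=> q0 /dvdnP [m qE] fp; rewrite qE mulnC in q0 *.
have m0 : (0 < m)%N by move: q0; rewrite muln_gt0 => /andP[].
rewrite /mean sum_resid_mul // -[_ *+ _]mulr_natr natrM exprMn natrX.
have mR : m%:R ^+ n != 0 :> R by rewrite expf_neq0 // pnatr_eq0 -lt0n.
have pR : p%:R ^+ n != 0 :> R by rewrite expf_neq0 // gt_eqF.
by rewrite -mulf_div divff // mulr1.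
Qed.

(** All translates of [f] have the same mean, so one may average over z first; for fixed x the
    conditions considered below become linear in z. *)
Lemma mean_shift (q : nat) (d : int) f : (0 < q)%N -> mod_periodic q f ->
  mean q f = mean q (fun x => mean p (fun z => f (x \+ (fun i => d * z i)))).
Proof.
move=> q0 fq; rewrite {1 2}/mean; congr (_ / _).
rewrite /mean -mulr_suml exchange_big /=.
have -> : \sum_(z : {ffun 'I_n -> 'I_p}) \sum_(x : {ffun 'I_n -> 'I_q})
    f (resid x \+ (fun i => d * resid z i)) =
  \sum_(z : {ffun 'I_n -> 'I_p}) \sum_(x : {ffun 'I_n -> 'I_q}) f (resid x).
  by apply: eq_bigr => z _; rewrite [RHS](sum_resid_shift (fun i => d * resid z i) q0 fq).
rewrite [X in _ = X / _]sumr_const card_ffun !card_ord -[_ *+ _]mulr_natr natrX mulfK //.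
by rewrite expf_neq0 // gt_eqF.
Qed.

(** The gradient is 3 B(x, x); its factor 3 is dropped, being invertible modulo the primes p > 3 of
    [Ssum_crit]. *)
Definition crit (m : nat) (x : 'I_n -> int) : bool :=
  dvdv (p ^ m) (fun k => bform c x x k).

Lemma dvdv_mod q : mod_periodic q (fun x : 'I_n -> int => dvdv q (fun k => bform c x x k)).
Proof.
move=> x y xy; apply: eq_forallb => k.
by apply/dvdz_mod0P/dvdz_mod0P; rewrite (bform_diag_modz csym k xy).
Qed.

Lemma mod_periodic_dvd T d q (f : ('I_n -> int) -> T) :
  (d %| q)%N -> mod_periodic d f -> mod_periodic q f.
Proof.
move=> dq fd x y xy; apply: fd => i; apply/eqz_modP.
by apply: (@dvdz_trans q%:Z); [exact: dq | exact/eqz_modP].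
Qed.

Lemma crit_mod m : mod_periodic (p ^ m) (crit m).
Proof. exact: dvdv_mod. Qed.

Hypothesis p_odd : (2 < p)%N.

Let cop2 : coprimez p 2.
Proof. by rewrite coprimezE /= prime_coprime // gtnNdvd. Qed.

(* If x and x + h are both critical, then 2 B(h, x) = - B(h, h) modulo p, a linear
   system in x with at most p^(n - r_p(h)) solutions. *)
Lemma crit_density q : (0 < q)%N -> (p %| q)%N ->
  mean q (fun x => (crit 1 x)%:R) ^+ 2 <= rank_sum / p%:R ^+ n.
Proof.
move=> q0 pq.
have per : mod_periodic p (fun x => (crit 1 x)%:R : R).
  by move=> x y xy; rewrite (@crit_mod 1 x y) // expn1.
rewrite mean_mod // /mean expr_div_n expr2 mulr_suml ler_pdivrMr ?exprn_gt0 ?exprn_gt0 //.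
have -> : rank_sum / p%:R ^+ n * p%:R ^+ n ^+ 2 = p%:R ^+ n * rank_sum.
  by have : p%:R ^+ n != 0 :> R; [rewrite expf_neq0 // gt_eqF | move=> ?; field].
have -> : \sum_(x : {ffun 'I_n -> 'I_p}) (crit 1 (resid x))%:R *
     (\sum_(y : {ffun 'I_n -> 'I_p}) (crit 1 (resid y))%:R) =
   \sum_(h : {ffun 'I_n -> 'I_p}) \sum_(x : {ffun 'I_n -> 'I_p})
     (crit 1 (resid x))%:R * (crit 1 (resid x \+ resid h))%:R :> R.
  rewrite exchange_big; apply: eq_bigr => x _ /=.
  rewrite (sum_resid_shift (resid x) p0 per) mulr_sumr.
  by apply: eq_bigr => h _; congr (_ * (crit 1 _)%:R); apply/funext => i /=; rewrite addrC.
rewrite mulr_sumr; apply: ler_sum => h _.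
rewrite /rank_weight -natr_expB ?rank_leq_row //.
apply: le_trans (_ : #|[set x : {ffun 'I_n -> 'I_p} |
   dvdv p (fun k => 2 * bform c (resid h) (resid x) k + bform c (resid h) (resid h) k)]|%:R
   <= _); last first.
  by rewrite ler_nat; exact: card_bform_mod.
rewrite -sum1_card natr_sum [X in _ <= X]big_mkcond; apply: ler_sum => x _ /=.
rewrite inE -natrM mulnb; case: ifPn => [_|]; first by rewrite (_ : 1 = 1%:R) // ler_nat leq_b1.
apply: contraNT; rewrite -ltNge ltr0n lt0b => /andP[/forallP h1 /forallP h2].
apply/forallP => k; have := h1 k; have := h2 k; rewrite expn1 => d2 d1.
have := rpredB d2 d1; rewrite bformDl // !bformDr // (bformC csym (resid x) (resid h)).
by congr (_ %| _)%Z; ring.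
Qed.

(* Replacing x by x + p^j z turns p^(j+1) | B(x, x) into a linear system modulo p
   in z, with matrix 2 M(x). *)
Lemma crit_descent (q j : nat) (w : ('I_n -> int) -> R) :
    (0 < q)%N -> (0 < j)%N -> (p ^ j.+1 %| q)%N ->
    (forall x, 0 <= w x) -> mod_periodic p w ->
  mean q (fun x => (crit j.+1 x)%:R * w x) <=
  mean q (fun x => (crit j x)%:R * (w x * rank_weight x)).
Proof.
move=> q0 j0 pq w0 wp.
have pq1 : (p %| q)%N by apply: dvdn_trans pq; rewrite expnS dvdn_mulr.
rewrite (mean_shift (p ^ j)%:Z) //; last first.
  move=> x y xy; congr ((nat_of_bool _)%:R * _).
    exact: (mod_periodic_dvd pq (@crit_mod j.+1)).
  exact: (mod_periodic_dvd pq1 wp).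
apply: mean_le => x.
have wE z : w (x \+ (fun i => (p ^ j)%:Z * z i)) = w x.
  apply: wp => i; apply/eqz_modP; rewrite /= addrC addKr dvdz_mulr //.
  by rewrite dvdzE /= dvdn_exp.
have critE z : crit j.+1 (x \+ (fun i => (p ^ j)%:Z * z i)) -> crit j x /\
    forall k, (p %| (2 * bform c x z k + (bform c x x k %/ (p ^ j)%N%:Z)%Z)%R)%Z.
  (* The part quadratic in z carries p^(2j), a multiple of p^(j + 1) because j >= 1. *)
  move=> /forallP h; have hk k :
      ((p ^ j.+1)%N%:Z %| (bform c x x k + 2 * (p ^ j)%:Z * bform c x z k)%R)%Z.
    have := h k; rewrite !(bformDl, bformDr csym, bformZl, bformZr csym).
    rewrite (bformC csym z x).
    set b1 := bform c x x k; set b2 := bform c x z k; set b3 := bform c z z k.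
    have -> : b1 + (p ^ j)%:Z * b2 + ((p ^ j)%:Z * b2 + (p ^ j)%:Z * ((p ^ j)%:Z * b3)) =
      b1 + 2 * (p ^ j)%:Z * b2 + (p ^ j)%:Z * (p ^ j)%:Z * b3 by ring.
    rewrite rpredDr // dvdz_mulr // -PoszM dvdzE /= -expnD dvdn_exp2l //.
    by rewrite -addn1 leq_add2l.
  have cx : crit j x.
    apply/forallP => k; have := hk k.
    have pjj : ((p ^ j)%N%:Z %| (p ^ j.+1)%N%:Z)%Z by rewrite dvdzE /= dvdn_exp2l.
    move=> /(dvdz_trans pjj).
    by rewrite rpredDr // -mulrA dvdz_mull // dvdz_mulr.
  split=> // k; have := hk k; move: cx => /forallP /(_ k) /dvdzP [b ->].
  have pj0 : (p ^ j)%:Z != 0 by rewrite eqz_nat -lt0n expn_gt0 p0.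
  rewrite mulzK // expnSr PoszM.
  have -> : b * (p ^ j)%:Z + 2 * (p ^ j)%:Z * bform c x z k =
    (p ^ j)%:Z * (2 * bform c x z k + b) by ring.
  by rewrite dvdz_mul2l.
rewrite /mean; under eq_bigr do rewrite wE.
rewrite -mulr_suml mulrAC [w x * _]mulrC mulrA ler_wpM2r //.
rewrite ler_pdivrMr ?exprn_gt0 // -mulrA [rank_weight _ * _]mulrC.
rewrite -natr_expB ?rank_leq_row //.
case: (boolP (crit j x)) => cx /=; last first.
  rewrite mul0r big1 // => z _; case: (boolP (crit j.+1 _)) => // /critE [h].
  by rewrite h in cx.
rewrite mul1r -natr_sum ler_nat.
apply: leq_trans (card_bform_mod csym x (fun k => (bform c x x k %/ (p ^ j)%N%:Z)%Z) p_pr cop2).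
rewrite -sum1dep_card [X in (_ <= X)%N]big_mkcond; apply: leq_sum => z _.
case: (boolP (crit j.+1 _)) => // /critE [_ h].
by rewrite (_ : dvdv _ _ = true) //; apply/forallP.
Qed.

Lemma mean_rank_weight q : (0 < q)%N -> (p %| q)%N ->
  mean q rank_weight = rank_sum / p%:R ^+ n.
Proof. by move=> q0 pq; rewrite mean_mod //; exact: rank_weight_mod. Qed.

(** A single descent step with weight 1, after which [crit 1] is bounded by 1. *)
Lemma crit2_density q : (0 < q)%N -> (p ^ 2 %| q)%N ->
  mean q (fun x => (crit 2 x)%:R) <= rank_sum / p%:R ^+ n.
Proof.
move=> q0 pq; rewrite -(@mean_rank_weight q) //; last first.
  by apply: dvdn_trans pq; rewrite dvdn_exp.
apply: le_trans (_ : mean q (fun x => (crit 2 x)%:R * 1) <= _).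
  by apply: mean_le => x; rewrite mulr1.
apply: le_trans (crit_descent (w := fun=> 1) q0 _ pq _ _) _ => //.
apply: mean_le => x; rewrite mul1r; case: crit; rewrite ?mul1r // mul0r.
exact: rank_weight_ge0.
Qed.

Lemma density_zero : mean p (fun x => (dvdv p x)%:R) <= (p%:R ^+ n)^-1.
Proof.
rewrite -[X in _ <= X]mul1r ler_wpM2r ?invr_ge0 ?exprn_ge0 //.
rewrite (bigD1 [ffun=> Ordinal p0]) //= big1 ?addr0.
  by case: dvdv.
move=> x x0; case: (boolP (dvdv p (resid x))) => // /forallP px.
case/eqP: x0; apply: eqmodv_resid => i; apply/eqz_modP.
by rewrite {2}/resid ffunE subr0.
Qed.

(* The vectors divisible by p have density p^(-n), and writing x = p y the condition
   becomes p | B(y, y); the others have rank at least 1, so the second descent step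
   gains a factor p. *)
Lemma crit3_density q : (0 < q)%N -> (p ^ 3 %| q)%N ->
    (forall u, rp c p u = 0%N -> dvdv p u) ->
  mean q (fun x => (crit 3 x)%:R) <=
    (mean p (fun x => (crit 1 x)%:R) + rank_sum / p%:R) / p%:R ^+ n.
Proof.
move=> q0 pq3 nondeg.
have pq1 : (p %| q)%N by apply: dvdn_trans pq3; rewrite dvdn_exp.
have pq2 : (p ^ 2 %| q)%N by apply: dvdn_trans pq3; rewrite dvdn_exp2l.
pose w (x : 'I_n -> int) : R := (~~ dvdv p x)%:R.
have dvdv_per : mod_periodic p (fun x : 'I_n -> int => dvdv p x).
  move=> x y xy; apply: eq_forallb => k.
  by apply/dvdz_mod0P/dvdz_mod0P; rewrite xy.
have wper : mod_periodic p w by move=> x y xy; rewrite /w (dvdv_per _ _ xy).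
have w0 x : 0 <= w x by rewrite ler0n.
apply: le_trans (_ : mean q (fun x => (crit 3 x)%:R * (dvdv p x)%:R + (crit 3 x)%:R * w x) <= _).
  by apply: mean_le => x; rewrite /w; case: dvdv; rewrite /= ?mulr1 ?mulr0 ?addr0 ?add0r.
rewrite meanD mulrDl; apply: lerD; last first.
  apply: le_trans (crit_descent q0 _ pq3 w0 wper) _ => //.
  have wr0 x : 0 <= w x * rank_weight x by rewrite mulr_ge0 ?rank_weight_ge0.
  have wrper : mod_periodic p (fun x => w x * rank_weight x).
    by move=> x y xy; rewrite (wper _ _ xy) (rank_weight_mod xy).
  apply: le_trans (crit_descent q0 _ pq2 wr0 wrper) _ => //.
  apply: le_trans (_ : mean q (fun x => p%:R^-1 * rank_weight x) <= _); last first.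
    by rewrite meanZ mean_rank_weight // mulrA [_^-1 * _]mulrC.
  apply: mean_le => x; rewrite mulrA ler_wpM2r ?rank_weight_ge0 //.
  case: crit; rewrite ?mul1r ?mul0r ?invr_ge0 //.
  rewrite /w; case: (boolP (dvdv p x)) => /= px; first by rewrite mul0r invr_ge0.
  rewrite mul1r /rank_weight; case E: (rp c p x) => [|r].
    by rewrite nondeg in px.
  rewrite exprS ler_piMr ?invr_ge0 // exprn_ile1 ?invr_ge0 //.
  by rewrite invf_le1 // ler1n.
(* For x divisible by p, passing to x + p z makes the quotient by p run over all classes modulo
   p. *)
rewrite (mean_shift p) //; last first.
  move=> x y xy; congr ((nat_of_bool _)%:R * (nat_of_bool _)%:R).
    exact: (mod_periodic_dvd pq3 (@crit_mod 3)).
  exact: (mod_periodic_dvd pq1 dvdv_per).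
pose N1 := mean p (fun x => (crit 1 x)%:R).
apply: le_trans (_ : mean q (fun x => N1 * (dvdv p x)%:R) <= _); last first.
  rewrite meanZ ler_wpM2l ?mean_ge0 //.
  rewrite mean_mod //.
    exact: density_zero.
  by move=> x y xy; rewrite (dvdv_per _ _ xy).
apply: mean_le => x.
have E z : dvdv p (x \+ (fun i => p%:Z * z i)) = dvdv p x.
  apply: dvdv_per => i; apply/eqz_modP; rewrite /= addrC addKr dvdz_mulr //.
case: (boolP (dvdv p x)) => px; last first.
  rewrite mulr0 /mean big1 ?mul0r // => z _; rewrite E (negbTE px) mulr0 //.
rewrite mulr1 /N1.
have crit1_per : mod_periodic p (fun x => (crit 1 x)%:R : R).
  by move=> u v uv; rewrite (@crit_mod 1 u v) // expn1.
pose y i := (x i %/ p)%Z.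
rewrite [X in _ <= X](_ : _ = mean p (fun z => (crit 1 (z \+ y))%:R)); last first.
  by rewrite /mean (sum_resid_shift y p0 crit1_per).
apply: mean_le => z; rewrite E px mulr1 ler_nat.
case: (boolP (crit 3 _)) => // /forallP h.
rewrite (_ : crit 1 _ = true) //; apply/forallP => k; have := h k.
have -> : x \+ (fun i => p%:Z * z i) = (fun i => p%:Z * (z \+ y) i).
  apply/funext => i /=; rewrite /y mulrDr addrC; congr (_ + _).
  by rewrite mulrC divzK //; move/forallP: px.
rewrite bformZl (bformZr csym) mulrA expn1 (_ : (p ^ 3)%N%:Z = (p%:Z * p%:Z) * p%:Z).
  by rewrite dvdz_mul2l // mulf_neq0 // eqz_nat -lt0n.
by rewrite -!PoszM; congr Posz; ring.
Qed.

Hypothesis p_gt3 : (3 < p)%N.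

(** Take Q = p^(k - m) and d = p^m in [Ssum_critical]; d divides Q because 2m <= k. *)
Lemma Ssum_crit k m a : (0 < m)%N -> (2 * m <= k)%N -> coprime a p ->
  normc (Ssum R c (p ^ k) a) / (p ^ k)%:R ^+ n <=
  mean (p ^ k) (fun x => (crit m x)%:R).
Proof.
move=> m0 mk ap; have mk' : (m <= k)%N by lia.
rewrite ler_wpM2r ?invr_ge0 ?exprn_ge0 //.
have pkE : (p ^ k = p ^ (k - m) * p ^ m)%N by rewrite -expnD subnK.
have d0 j : (0 < p ^ j)%N by rewrite expn_gt0 p0.
have dQ : (p ^ m %| p ^ (k - m))%N by rewrite dvdn_exp2l //; lia.
rewrite pkE; apply: le_trans (Ssum_critical R csym (d0 _) (d0 _) dQ _) _.
  by rewrite coprimeXr.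
rewrite -sum1_card natr_sum [X in X <= _]big_mkcond; apply: ler_sum => x _.
rewrite inE dvdv_coprime; first by rewrite -/(crit m _); case: crit.
rewrite coprimezE /= coprimeXl // prime_coprime // gtnNdvd //.
Qed.

(** With r = r_p(h), [Zcount] is at most p^(n - r), so h contributes at most p^n p^(-r/2) to
    [weyl_step]. Then p^(-r/2) <= p^(n/2) p^(-r) produces D(p). *)
Lemma Ssum_prime a : coprime a p ->
  normc (Ssum R c p a) ^+ 2 <= p%:R ^+ n * Num.sqrt (p%:R ^+ n) * rank_sum.
Proof.
move=> ap; apply: le_trans (weyl_step R csym p0 ap) _.
rewrite /rank_sum mulr_sumr; apply: ler_sum => h _.
set r := rp c p (resid h).
have rn : (r <= n)%N by exact: rank_leq_row.
have Z : (Zcount c p (resid h) <= p ^ (n - r))%N.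
  have c6 : coprimez p 6.
    rewrite coprimezE; change (coprime p (2 * 3)); rewrite coprimeMr !prime_coprime //.
    by rewrite !gtnNdvd.
  apply: leq_trans (card_bform_mod csym (resid h) (fun=> 0) p_pr c6).
  apply: eq_leq; apply: eq_card => y; rewrite !inE.
  by apply: eq_forallb => k; rewrite addr0.
apply: le_trans (_ : Num.sqrt (p%:R ^+ n * (p%:R ^+ n * p%:R^-1 ^+ r)) <= _).
  rewrite ler_sqrt ?mulr_ge0 ?exprn_ge0 ?invr_ge0 //.
  by rewrite -natr_expB // natrM natrX ler_wpM2l ?exprn_ge0 // ler_nat.
rewrite /rank_weight -/r mulrA sqrtrM ?mulr_ge0 ?exprn_ge0 //.
rewrite -expr2 sqrtr_sqr ger0_norm ?exprn_ge0 // -mulrA ler_wpM2l ?exprn_ge0 //.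
set v := p%:R^-1 ^+ r; have v0 : 0 <= v by rewrite exprn_ge0 // invr_ge0.
have vE : v = Num.sqrt v * Num.sqrt v by rewrite -expr2 sqr_sqrtr.
rewrite [X in _ <= _ * X]vE mulrA ler_peMl ?sqrtr_ge0 //.
rewrite -sqrtrM ?exprn_ge0 // -natr_expB // -[X in X <= _]sqrtr1 ler_sqrt //.
by rewrite ler1n expn_gt0 p0.
Qed.

End PrimePowers.

(** * The terms at prime powers *)

Section PrimeBound.
Variables (R : realType) (c : coeffs 9).
Hypothesis csym : symmetric_coeffs c.
Hypothesis dgc : davenport_geometric R c.

(* [sing_term] is indexed from 0; the value of [sing_at] at 0 is irrelevant. *)
Definition sing_at (q : nat) : R := sing_term R c q.-1.

Lemma sing_atE q : (0 < q)%N ->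
  sing_at q = \sum_(a < q | coprime a q) normc (Ssum R c q a) / q%:R ^+ 9.
Proof.
case: q => // q _; rewrite /sing_at /sing_term /=.
by apply: eq_bigr => a _; rewrite S_absE.
Qed.

Lemma sing_at_ge0 q : 0 <= sing_at q.
Proof. by apply: sumr_ge0 => a _; rewrite divr_ge0 ?exprn_ge0 ?sqrtr_ge0. Qed.

Lemma sing_at_le q (b : R) : (0 < q)%N -> 0 <= b ->
    (forall a, coprime a q -> normc (Ssum R c q a) / q%:R ^+ 9 <= b) ->
  sing_at q <= q%:R * b.
Proof.
move=> q0 b0 hb; rewrite sing_atE // big_mkcond /=.
apply: le_trans (_ : \sum_(a < q) b <= _); last by rewrite sumr_const card_ord mulr_natl.
by apply: ler_sum => a _; case: ifPn => // /hb.
Qed.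

Lemma sing_at_trivial q : (0 < q)%N -> sing_at q <= q%:R.
Proof.
move=> q0; rewrite -[X in _ <= X]mulr1; apply: sing_at_le => // a _.
by rewrite ler_pdivrMr ?exprn_gt0 ?ltr0n // mul1r -natrX; exact: Ssum_le.
Qed.

(* 3/25 = (9 - 1/25) / 8 - 1. *)
Lemma sing_at_weyl : exists2 K : R, 0 <= K &
  forall q, (0 < q)%N -> sing_at q <= K * q%:R `^ (- (3 / 25)).
Proof.
have [||K K0 hK] := @weyl_bound R 9 c csym dgc (1 / 25); [by lra | by lra | ].
exists K => // q q0.
apply: le_trans (sing_at_le q0 _ (fun a => hK q a q0)) _.
  by rewrite mulr_ge0 ?powR_ge0.
rewrite mulrCA ler_wpM2l //.
have -> : q%:R * q%:R `^ (- ((9%:R - 1 / 25) / 8)) =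
    q%:R `^ 1 * q%:R `^ (- ((9%:R - 1 / 25) / 8)) :> R by rewrite powRr1.
rewrite -powRD ?pnatr_eq0 -?lt0n ?q0 ?implybT //.
by rewrite ler_powR ?ler1n //; lra.
Qed.

(** For p = 2 and p = 3 the trivial bound A(q) <= q <= 3^8 is enough, as p^(-27/25) >= 3^(-2) and
    D(p) >= 1. *)
Lemma sing_at_pow_small p k : prime p -> (p <= 3)%N -> (k < 9)%N ->
  sing_at (p ^ k) <= 3 ^+ 10 * (p%:R `^ (- (27 / 25)) * rank_sum R c p).
Proof.
move=> p_pr p3 k9; have p0 := prime_gt0 p_pr.
apply: le_trans (sing_at_trivial _) _; first by rewrite expn_gt0 p0.
have h1 : (3 ^+ 2)^-1 <= p%:R `^ (- (27 / 25)) :> R.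
  apply: le_trans (_ : p%:R `^ (- 2) <= _).
    rewrite powR_invn // lef_pV2 ?posrE ?exprn_gt0 ?ltr0n //.
    by rewrite lerXn2r ?nnegrE // ler_nat.
  by rewrite ler_powR ?ler1n //; lra.
have h2 := rank_sum_ge1 R c p_pr.
apply: le_trans (_ : 3 ^+ 8 <= _).
  rewrite natrX; apply: le_trans (_ : 3 ^+ k <= _).
    by rewrite lerXn2r ?nnegrE // ler_nat.
  by rewrite ler_weXn2l // ler1n.
apply: le_trans (_ : 3 ^+ 10 * ((3 ^+ 2)^-1 * 1) <= _); first by lra.
by rewrite ler_wpM2l // ler_pM.
Qed.

(** * Small powers of a prime larger than 3 *)

Section LargePrime.
Variables (p : nat).
Hypotheses (p_pr : prime p) (p_gt3 : (3 < p)%N).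
Let P : R := p%:R.
Let D : R := rank_sum R c p.

Let P1 : 1 <= P. Proof. by rewrite ler1n prime_gt0. Qed.
Let P0 : 0 < P. Proof. exact: lt_le_trans P1. Qed.
Let D1 : 1 <= D. Proof. exact: rank_sum_ge1. Qed.
Let D0 : 0 <= D. Proof. exact: le_trans D1. Qed.
Let p_gt2 : (2 < p)%N. Proof. exact: ltnW. Qed.
Let Pn0 : P != 0. Proof. by rewrite gt_eqF. Qed.

Let powRDP s t : P `^ (s + t) = P `^ s * P `^ t.
Proof. by rewrite powRD // Pn0 implybT. Qed.

Let powRnat k : P ^+ k = P `^ k%:R. Proof. by rewrite powR_mulrn // ltW. Qed.

(** Any exponent s >= 27/25 is good enough; the cases below yield 5/4, 3/2 and 2. *)
Lemma le_rank_sum_pow (C x s : R) : 0 <= C -> x <= C * P `^ (- s) * D ->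
  27 / 25 <= s -> x <= C * (P `^ (- (27 / 25)) * D).
Proof.
move=> C0 hx hs; apply: le_trans hx _; rewrite -mulrA ler_wpM2l // ler_wpM2r //.
by rewrite ler_powR // lerN2.
Qed.

(** [Ssum_prime] gives |S| / p^9 <= p^(-9/4) D^(1/2) <= p^(-9/4) D, and there are at most p values
    of a. *)
Lemma sing_at_prime : sing_at p <= 1 * (P `^ (- (27 / 25)) * D).
Proof.
apply: (@le_rank_sum_pow _ _ (5 / 4)) => //; last by lra.
have p0 := prime_gt0 p_pr.
have -> : 1 * P `^ (- (5 / 4)) * D = P * (P `^ (- (9 / 4)) * D).
  rewrite mul1r mulrA; congr (_ * _).
  transitivity (P `^ 1 * P `^ (- (9 / 4))); last by rewrite powRr1 // ltW.
  by rewrite -powRDP; congr powR; lra.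
apply: sing_at_le => // [|a ap]; first by rewrite mulr_ge0 ?powR_ge0.
rewrite -(@ler_pXn2r _ 2) ?nnegrE ?mulr_ge0 ?divr_ge0 ?powR_ge0 ?exprn_ge0 ?normc_ge0 ?ler0n //.
rewrite expr_div_n ler_pdivrMr ?exprn_gt0 //.
apply: le_trans (Ssum_prime R csym p_pr p_gt2 p_gt3 ap) _; rewrite -/P -/D.
rewrite exprMn -[_ `^ _ ^+ 2]powR_mulrn ?powR_ge0 // -powRrM.
rewrite -[Num.sqrt _]powR12_sqrt ?exprn_ge0 ?(ltW P0) // -exprM powRnat -powRrM (powRnat (9 * 2)).
rewrite -powRDP mulrAC -powRDP.
have -> : 9%:R + 9%:R / 2 = - (9 / 4) * 2%:R + (9 * 2)%:R :> R by rewrite natrM; lra.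
by rewrite ler_wpM2l ?powR_ge0 // expr2 ler_peMl.
Qed.

Lemma mean_crit1_le k : (0 < k)%N ->
  mean (p ^ k) (fun x => (crit c p 1 x)%:R) <= P `^ (- (9 / 2)) * D.
Proof.
move=> k0; have h := @crit_density R 9 c p csym p_pr p_gt2 (p ^ k).
have m0 : 0 <= mean (p ^ k) (fun x => (crit c p 1 x)%:R) :> R by exact: mean_ge0.
have b0 : 0 <= P `^ (- (9 / 2)) * D by rewrite mulr_ge0 ?powR_ge0.
rewrite -(@ler_pXn2r _ 2) ?nnegrE //.
apply: le_trans (h _ _) _; rewrite ?expn_gt0 ?prime_gt0 ?dvdn_exp // -/P -/D.
rewrite exprMn -[_ `^ _ ^+ 2]powR_mulrn ?powR_ge0 // -powRrM mulrC -powR_invn ?(ltW P0) //.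
have -> : - (9 / 2) * 2%:R = - 9%:R :> R by lra.
by rewrite ler_wpM2l ?powR_ge0 // expr2 ler_peMl.
Qed.

Lemma sing_at_pow k b : (0 < k)%N -> 0 <= b ->
    (forall a, coprime a p -> normc (Ssum R c (p ^ k) a) / (p ^ k)%:R ^+ 9 <= b) ->
  sing_at (p ^ k) <= P `^ k%:R * b.
Proof.
move=> k0 b0 hb; rewrite -powRnat -natrX; apply: sing_at_le => //.
  by rewrite expn_gt0 prime_gt0.
by move=> a; rewrite coprime_pexpr // => /hb.
Qed.

(** Taking m = 1 gives p^(k - 9/2) D, with k - 9/2 <= -3/2. *)
Lemma sing_at_23 k : (1 < k < 4)%N ->
  sing_at (p ^ k) <= 1 * (P `^ (- (27 / 25)) * D).
Proof.
move=> /andP[k2 k4]; apply: (@le_rank_sum_pow _ _ (3 / 2)) => //; last by lra.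
apply: le_trans (sing_at_pow (b := P `^ (- (9 / 2)) * D) _ _ _) _.
- exact: ltnW.
- by rewrite mulr_ge0 ?powR_ge0.
- move=> a ap; apply: le_trans (mean_crit1_le (k := k) _); last exact: ltnW.
  exact: Ssum_crit.
rewrite mul1r mulrA ler_wpM2r // -powRDP ler_powR //.
have : k%:R <= 3%:R :> R by rewrite ler_nat.
by lra.
Qed.

(** Taking m = 2 gives p^(k - 9) D, with k - 9 <= -2. At k = 8 this would be p^(-1) D, which is too
    large. *)
Lemma sing_at_4567 k : (3 < k < 8)%N ->
  sing_at (p ^ k) <= 1 * (P `^ (- (27 / 25)) * D).
Proof.
move=> /andP[k4 k8]; apply: (@le_rank_sum_pow _ _ 2) => //; last by lra.
apply: le_trans (sing_at_pow (b := P `^ (- 9%:R) * D) _ _ _) _.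
- by lia.
- by rewrite mulr_ge0 ?powR_ge0.
- move=> a ap; rewrite powR_invn ?(ltW P0) // [X in _ <= X]mulrC.
  apply: le_trans (Ssum_crit R csym p_pr p_gt2 p_gt3 (m := 2) _ _ ap) _ => //.
  by apply: crit2_density; rewrite ?expn_gt0 ?prime_gt0 // dvdn_exp2l // ltnW // ltnW.
rewrite mul1r mulrA ler_wpM2r // -powRDP ler_powR //.
have : k%:R <= 7%:R :> R by rewrite ler_nat.
by lra.
Qed.

(* When M(u) vanishes modulo p for some u <> 0 the density bound fails, but then
   D(p) >= p, so Weyl's inequality is enough. *)
Lemma sing_at_8 (K : R) : 0 <= K ->
    (forall q, (0 < q)%N -> sing_at q <= K * q%:R `^ (- (3 / 25))) ->
  sing_at (p ^ 8) <= (K + 2) * (P `^ (- (27 / 25)) * D).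
Proof.
move=> K0 hK.
have [nondeg|deg] := pselect (forall u, rp c p u = 0%N -> dvdv p u).
  apply: le_trans (_ : 2 * (P `^ (- (27 / 25)) * D) <= _); last first.
    by rewrite ler_wpM2r ?lerDr // mulr_ge0 ?powR_ge0.
  apply: (@le_rank_sum_pow _ _ 2) => //; last by lra.
  (* The case m = 3 saves a further factor p, so the final exponent is 8 - 9 - 1 = -2. *)
  apply: le_trans (sing_at_pow (b := P `^ (- 9%:R) * (2 * P `^ (- 1) * D)) _ _ _) _.
  - by [].
  - by rewrite !mulr_ge0 ?powR_ge0.
  - move=> a ap; rewrite powR_invn ?(ltW P0) // [X in _ <= X]mulrC.
    apply: le_trans (Ssum_crit R csym p_pr p_gt2 p_gt3 (m := 3) _ _ ap) _ => //.
    apply: le_trans (crit3_density R csym p_pr p_gt2 _ _ nondeg) _.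
    + by rewrite expn_gt0 prime_gt0.
    + by rewrite dvdn_exp2l.
    rewrite -/P ler_wpM2r ?invr_ge0 ?exprn_ge0 ?(ltW P0) //.
    have := mean_crit1_le (k := 1) isT; rewrite expn1 => /lerD h.
    apply: le_trans (h _ _ (lexx _)) _; rewrite -/D (powR_inv1 (ltW P0)).
    have e : P `^ (- (9 / 2)) <= P^-1.
      by rewrite -(powR_inv1 (ltW P0)) ler_powR //; lra.
    by have := ler_wpM2r D0 e; lra.
  rewrite !mulrA ler_wpM2r // -powRDP mulrAC -powRDP mulrC.
  by rewrite ler_wpM2l // ler_powR //; lra.
have [u [u0 /negP]] : exists u, rp c p u = 0%N /\ ~ dvdv p u.
  by move/existsNP: deg => [u /not_implyP]; exists u.
rewrite negb_forall => /existsP [i pui].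
have PD : P <= D by exact: (rank_sum_degenerate R p_pr u0 pui).
apply: le_trans (_ : K * (P `^ (- (27 / 25)) * D) <= _); last first.
  by rewrite ler_wpM2r ?lerDl // mulr_ge0 ?powR_ge0.
apply: le_trans (hK _ _) _; first by rewrite expn_gt0 prime_gt0.
rewrite ler_wpM2l // natrX -/P powRnat -powRrM.
(* Weyl's inequality gives p^(-24/25), which is at most p^(-27/25) p, and p <= D(p). *)
apply: le_trans (_ : P `^ (- (27 / 25)) * P <= _); last by rewrite ler_wpM2l ?powR_ge0.
have -> : P `^ (- (27 / 25)) * P = P `^ (- (27 / 25)) * P `^ 1 by rewrite powRr1 // ltW.
by rewrite -powRDP ler_powR //; lra.
Qed.

End LargePrime.

Lemma geom_sum_le (x : R) m : 0 <= x < 1 -> \sum_(0 <= j < m) x ^+ j <= (1 - x)^-1.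
Proof.
move=> /andP[x0 x1]; have x10 : 0 < 1 - x by rewrite subr_gt0.
rewrite -[X in _ <= X]mul1r ler_pdivlMr //.
have -> : (\sum_(0 <= j < m) x ^+ j) * (1 - x) = 1 - x ^+ m.
  elim: m => [|m IH]; first by rewrite big_nil mul0r expr0 subrr.
  by rewrite big_nat_recr //= mulrDl IH exprSr; ring.
by rewrite gerBl exprn_ge0.
Qed.

(** The eight terms with k < 9 are bounded one by one. From k = 9 on, Weyl's inequality gives a
    geometric series of ratio x = p^(-3/25) <= 2^(-3/25), starting at a multiple of x^9 =
    p^(-27/25). *)
Lemma sing_at_prime_powers : exists2 K : R, 0 <= K &
  forall p X, prime p ->
    \sum_(1 <= k < X) sing_at (p ^ k) <= K * (p%:R `^ (- (27 / 25)) * rank_sum R c p).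
Proof.
have [K K0 hK] := sing_at_weyl.
pose rho : R := 2 `^ (- (3 / 25)).
have rho0 : 0 <= rho by exact: powR_ge0.
have rho1 : rho < 1.
  rewrite /rho powRN invf_lt1 ?powR_gt0 // -[X in X < _](congr1 (fun f => f (3 / 25)) (powR1 R)).
  by apply: gt0_ltr_powR; rewrite ?nnegrE ?ltr1n //; lra.
pose C := 3 ^+ 10 + K + 2 : R.
have C0 : 0 <= C by rewrite !addr_ge0.
exists (8 * C + K / (1 - rho)) => [|p X p_pr].
  by rewrite addr_ge0 ?mulr_ge0 // invr_ge0 subr_ge0 ltW.
have p0 := prime_gt0 p_pr; have p1 := prime_gt1 p_pr.
have P1 : 1 <= p%:R :> R by rewrite ler1n.
have D1 := rank_sum_ge1 R c p_pr.
set D := rank_sum R c p in D1 *; set Y := _ * D.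
have Y0 : 0 <= Y by rewrite mulr_ge0 ?powR_ge0 // (le_trans ler01).
(* The range is enlarged so that it can be split at 9 whatever [X] is. *)
apply: le_trans (_ : \sum_(1 <= k < X + 9) sing_at (p ^ k) <= _).
  case: (posnP X) => [->|X0]; first by rewrite big_geq // sumr_ge0 // => k _; exact: sing_at_ge0.
  rewrite [X in _ <= X](@big_cat_nat _ _ _ X) ?leq_addr //= lerDl sumr_ge0 // => k _.
  exact: sing_at_ge0.
rewrite (@big_cat_nat _ _ _ 9) ?leq_addl //= mulrDl; apply: lerD.
  apply: le_trans (_ : \sum_(1 <= k < 9) C * Y <= _); last first.
    by rewrite sumr_const_nat -mulrA mulr_natl.
  apply: ler_sum_nat => k /andP[k1 k9].
  case: (leqP p 3) => p3.
    apply: le_trans (sing_at_pow_small p_pr p3 k9) _.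
    by rewrite ler_wpM2r // /C -addrA lerDl addr_ge0.
  have C1 : 1 <= C by rewrite /C; have : 1 <= 3 ^+ 10 :> R; [rewrite exprn_ege1 // ler1n | lra].
  have hC x : x <= 1 * Y -> x <= C * Y by move=> /le_trans; apply; rewrite ler_wpM2r.
  have [k2|] := ltnP k 2.
    have -> : k = 1%N by lia.
    by rewrite expn1; apply: hC; exact: sing_at_prime.
  move=> k2; have [k4|k4] := ltnP k 4; first by apply: hC; apply: sing_at_23; rewrite ?k2.
  have [k8|k8] := ltnP k 8; first by apply: hC; apply: sing_at_4567; rewrite ?k4.
  have -> : k = 8%N by lia.
  apply: le_trans (sing_at_8 p_pr p3 K0 hK) _.
  by rewrite ler_wpM2r // /C -addrA lerDr exprn_ge0.
pose x : R := p%:R `^ (- (3 / 25)).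
have x0 : 0 <= x by exact: powR_ge0.
have xrho : x <= rho.
  rewrite /x /rho !powRN lef_pV2 ?posrE ?powR_gt0 ?ltr0n //.
  by rewrite ge0_ler_powR ?nnegrE ?ler0n ?ler_nat //; lra.
have x1 : x < 1 by exact: le_lt_trans rho1.
apply: le_trans (_ : \sum_(9 <= k < X + 9) K * x ^+ k <= _).
  apply: ler_sum_nat => k _; apply: le_trans (hK _ _) _; first by rewrite expn_gt0 p0.
  rewrite natrX -[p%:R ^+ k]powR_mulrn ?ler0n // -powRrM mulrC [k%:R * _]mulrC.
  by rewrite powRrM powR_mulrn ?powR_ge0 // mulrC.
rewrite -mulr_sumr -mulrA ler_wpM2l // -{1}[9%N]add0n big_addn addnK.
under eq_bigr do rewrite exprD.
rewrite -mulr_suml ler_pM ?exprn_ge0 ?sumr_ge0 // => [j _||].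
- by rewrite exprn_ge0.
- apply: le_trans (geom_sum_le _ _) _; first by rewrite x0.
  by rewrite lef_pV2 ?posrE ?subr_gt0 // lerB.
rewrite -powR_mulrn // /x -powRrM /Y (_ : - (3 / 25) * 9%:R = - (27 / 25)); last by lra.
by rewrite ler_peMr ?powR_ge0.
Qed.

End PrimeBound.

(** * The sum over primes and the Euler product *)

Section DyadicSum.
Variables (R : realType) (c : coeffs 9).

(** Because M < p <= 2M, replacing each coordinate above M by its difference with p puts a
    representative of every class into the box of radius M. Counting ranks at most r, instead of
    equal to r, matches [pair_hypothesis]. *)
Lemma rank_sum_le_box (p M : nat) : prime p -> (M < p)%N -> (p <= 2 * M)%N ->
  rank_sum R c p <= \sum_(r < 10)
    #|[set v : {ffun 'I_9 -> 'I_(2 * M).+1} | (rp c p (box_pt v) <= r)%N]|%:R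
      * M%:R^-1 ^+ r.
Proof.
move=> p_pr Mp pM; have p0 := prime_gt0 p_pr.
have M0 : (0 < M)%N by lia.
rewrite /rank_sum (sum_partition_nat (m := 10) (fun r => p%:R^-1 ^+ r)); last first.
  by move=> h; rewrite ltnS rank_leq_row.
apply: ler_sum => r _; apply: ler_pM; rewrite ?ler0n ?exprn_ge0 ?invr_ge0 //; last first.
  rewrite lerXn2r ?nnegrE ?invr_ge0 ?ler0n // lef_pV2 ?posrE ?ltr0n //.
  by rewrite ler_nat ltnW.
rewrite ler_nat.
pose g (h : {ffun 'I_9 -> 'I_p}) : {ffun 'I_9 -> 'I_(2 * M).+1} :=
  [ffun i => inord (if (h i <= M)%N then (h i + M)%N else (h i + M - p)%N)].
have gE h i : box_pt (g h) i = (h i)%:Z - (if (h i <= M)%N then 0%N else p)%:Z.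
  have hp := ltn_ord (h i); move: hp; rewrite /box_pt ffunE.
  case: (leqP (h i) M) => hM hp; rewrite inordK; lia.
have g_mod h : eqmodv p (box_pt (g h)) (resid h).
  move=> i; apply/eqz_modP; rewrite gE /resid addrC addKr.
  by rewrite rpredN; case: ifP => _; rewrite ?dvdz0 ?dvdzz.
rewrite -(card_in_imset (f := g)); last first.
  move=> h1 h2 _ _ e; apply: eqmodv_resid.
  by apply: eqmodv_trans (eqmodv_sym (g_mod h1)) _; rewrite e; exact: g_mod.
apply: subset_leq_card; apply/fintype.subsetP => _ /imsetP[h + ->].
by rewrite !inE (rp_mod c p_pr (g_mod h)) => /eqP ->.
Qed.

Hypothesis pairs : pair_hypothesis R c.

Definition prime_weight (p : nat) : R := p%:R `^ (- (27 / 25)) * rank_sum R c p.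

Lemma prime_weight_ge0 p : 0 <= prime_weight p.
Proof.
by rewrite mulr_ge0 ?powR_ge0 // sumr_ge0 // => h _; exact: rank_weight_ge0.
Qed.

(** The averaged hypothesis is used with H = R = M and eps = 1/25. Its factor M^r cancels the weight
    M^(-r), leaving M^(26/25) against M^(-27/25). *)
Lemma dyadic_sum : exists2 K : R, 0 <= K & forall M, (0 < M)%N ->
  \sum_(p < (2 * M).+1 | prime p && (M < p)%N) prime_weight p <=
  K * M%:R `^ (- (1 / 25)).
Proof.
have /(_ _)/cid-/all_sig [K KP] : forall r : 'I_10, exists K : R, forall H Rr : R,
    1 <= H -> H <= Rr ->
    (count_pairs c H Rr r)%:R <= K * H ^+ r * Rr `^ (1 + 1 / 25).
  by move=> r; apply: pairs; [rewrite -ltnS | lra].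
exists (\sum_(r < 10) `|K r|) => [|M M0]; first exact: sumr_ge0.
pose T : R := M%:R; have T1 : 1 <= T by rewrite ler1n.
have T0 : 0 < T by exact: lt_le_trans T1.
pose cnt (p r : nat) :=
  #|[set v : {ffun 'I_9 -> 'I_(2 * M).+1} | (rp c p (box_pt v) <= r)%N]|.
have cntE r : count_pairs c T T r =
    (\sum_(p < (2 * M).+1 | prime p && (M < p)%N) cnt p r)%N.
  rewrite /count_pairs /T -natrM !natrK; apply: eq_big => [p|p _].
    by have := ltn_ord p; rewrite ltr_nat ler_nat ltnS => ->; rewrite andbT.
  apply: eq_card => v; rewrite !inE; case: leqP; rewrite ?andbF // andbT => _.
  by apply/forallP => i; rewrite -[M%:R]/(M%:Z%:~R) ler_int norm_box_pt.
apply: le_trans (_ : \sum_(p < (2 * M).+1 | prime p && (M < p)%N)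
    T `^ (- (27 / 25)) * (\sum_(r < 10) (cnt p r)%:R * T^-1 ^+ r) <= _).
  apply: ler_sum => p /andP[p_pr Mp]; apply: ler_pM; rewrite ?powR_ge0 //.
  - by rewrite sumr_ge0 // => h _; exact: rank_weight_ge0.
  - rewrite !powRN lef_pV2 ?posrE ?powR_gt0 ?ltr0n ?(prime_gt0 p_pr) //.
    by rewrite ge0_ler_powR ?nnegrE ?ler0n ?ler_nat ?(ltnW Mp) //; lra.
  by apply: rank_sum_le_box => //; rewrite -ltnS.
rewrite -mulr_sumr exchange_big /=.
apply: le_trans (_ : T `^ (- (27 / 25)) * \sum_(r < 10) `|K r| * T `^ (1 + 1 / 25) <= _).
  rewrite ler_wpM2l ?powR_ge0 //; apply: ler_sum => r _.
  rewrite -mulr_suml -natr_sum -cntE exprVn ler_pdivrMr ?exprn_gt0 // mulrAC.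
  apply: le_trans (KP r T T T1 (lexx _)) _.
  by rewrite ler_wpM2r ?powR_ge0 // ler_wpM2r ?exprn_ge0 ?(ltW T0) // ler_norm.
rewrite -mulr_suml mulrCA ler_wpM2l ?sumr_ge0 //.
rewrite -powRD ?(gt_eqF T0) ?implybT //.
by rewrite ler_powR //; lra.
Qed.

(** The blocks 2^j < p <= 2^(j + 1) are dominated by a geometric series of ratio 2^(-1/25). *)
Lemma prime_sum_bounded : exists2 B : R, 0 <= B & forall X,
  \sum_(0 <= p < X | prime p) prime_weight p <= B.
Proof.
have [K K0 hK] := dyadic_sum.
pose rho : R := 2 `^ (- (1 / 25)).
have rho0 : 0 <= rho by exact: powR_ge0.
have rho1 : rho < 1.
  rewrite /rho powRN invf_lt1 ?powR_gt0 // -[X in X < _](congr1 (fun f => f (1 / 25)) (powR1 R)).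
  by apply: gt0_ltr_powR; rewrite ?nnegrE ?ltr1n //; lra.
exists (K * (1 - rho)^-1) => [|X]; first by rewrite mulr_ge0 // invr_ge0 subr_ge0 ltW.
have dy J : \sum_(0 <= p < (2 ^ J).+1 | prime p) prime_weight p <=
    K * \sum_(0 <= j < J) rho ^+ j.
  elim: J => [|J IH].
    (* For [J = 0] the range consists of 0 and 1 and contains no prime. *)
    by rewrite [X in _ <= _ * X]big_geq // mulr0 expn0 big_mkcond big_nat_recr //= big_nat1 add0r.
  rewrite [X in _ <= _ * X]big_nat_recr //= mulrDr.
  rewrite (@big_cat_nat _ _ _ (2 ^ J).+1) //=; last by rewrite ltnS leq_exp2l.
  apply: lerD => //; have M0 : (0 < 2 ^ J)%N by rewrite expn_gt0.
  apply: le_trans (_ : K * (2 ^ J)%:R `^ (- (1 / 25)) <= _); last first.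
    rewrite ler_wpM2l // natrX -[2 ^+ J]powR_mulrn // -powRrM mulrC powRrM.
    by rewrite powR_mulrn ?powR_ge0.
  apply: le_trans (hK _ M0); rewrite expnS.
  rewrite -(big_mkord (fun p => prime p && (2 ^ J < p)%N)) /=.
  rewrite [X in _ <= X](@big_cat_nat _ _ _ (2 ^ J).+1) //=; last by rewrite ltnS leq_pmull.
  rewrite -[X in X <= _]add0r; apply: lerD.
    by apply: sumr_ge0 => p _; exact: prime_weight_ge0.
  rewrite big_nat_cond [X in _ <= X]big_nat_cond le_eqVlt; apply/orP; left; apply/eqP.
  by apply: eq_bigl => p; case: (ltnP (2 ^ J) p) => //= _; rewrite andbT.
apply: le_trans (_ : \sum_(0 <= p < (2 ^ X).+1 | prime p) prime_weight p <= _).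
  rewrite [X in _ <= X](@big_cat_nat _ _ _ X) //=; last first.
    by rewrite ltnW // ltnS ltnW // ltn_expl.
  by rewrite lerDl; apply: sumr_ge0 => p _; exact: prime_weight_ge0.
apply: le_trans (dy X) _; rewrite ler_wpM2l // geom_sum_le //.
by rewrite rho0.
Qed.

End DyadicSum.

(** * Submultiplicativity and partial Euler products *)

Lemma modn_mul_cancel q m a b :
  coprime q m -> (a * m = b * m %[mod q])%N -> (a = b %[mod q])%N.
Proof.
move=> qm e.
have /eqz_modP : ((a * m)%N%:Z = (b * m)%N%:Z %[mod q])%Z by rewrite !modz_nat e.
by rewrite !PoszM -mulrBl Gauss_dvdzl // => /eqz_modP; rewrite !modz_nat => -[].
Qed.

Section EulerProduct.
Variables (R : realType) (c : coeffs 9).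
Hypothesis csym : symmetric_coeffs c.
Local Notation sing_at := (@sing_at R c).

(** By [Ssum_mul], the term of a splits along the pair (a q2^2 mod q1, a q1^2 mod q2). The Chinese
    remainder theorem makes this map injective, which yields the inequality. *)
Lemma sing_at_mul q1 q2 : (0 < q1)%N -> (0 < q2)%N -> coprime q1 q2 ->
  sing_at (q1 * q2) <= sing_at q1 * sing_at q2.
Proof.
move=> q10 q20 cop; have q0 : (0 < q1 * q2)%N by rewrite muln_gt0 q10.
rewrite !sing_atE // mulr_suml.
under [X in _ <= X]eq_bigr do rewrite mulr_sumr.
rewrite pair_big /=.
have lt1 a : (a * q2 ^ 2 %% q1 < q1)%N by rewrite ltn_mod.
have lt2 a : (a * q1 ^ 2 %% q2 < q2)%N by rewrite ltn_mod.
pose f (a : 'I_(q1 * q2)) := (Ordinal (lt1 a), Ordinal (lt2 a)).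
have -> : \sum_(a < q1 * q2 | coprime a (q1 * q2))
    normc (Ssum R c (q1 * q2) a) / (q1 * q2)%:R ^+ 9 =
  \sum_(a < q1 * q2 | coprime a (q1 * q2))
    (normc (Ssum R c q1 (f a).1) / q1%:R ^+ 9) * (normc (Ssum R c q2 (f a).2) / q2%:R ^+ 9).
  apply: eq_bigr => a _; rewrite /f /= !Ssum_mod // Ssum_mul // normcM natrM exprMn.
  by rewrite mulf_div.
have cop12 : coprime q1 (q2 ^ 2) by rewrite coprimeXr.
have cop21 : coprime q2 (q1 ^ 2) by rewrite coprimeXr // coprime_sym.
apply: (ler_sum_inj (f := f) (Q := fun u : 'I_q1 * 'I_q2 => coprime u.1 q1 && coprime u.2 q2)
   (F := fun u => (normc (Ssum R c q1 u.1) / q1%:R ^+ 9) * (normc (Ssum R c q2 u.2) / q2%:R ^+ 9))).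
- move=> a b _ _ [/(modn_mul_cancel cop12) e1 /(modn_mul_cancel cop21) e2]; apply/val_inj => /=.
  have : (a == b %[mod q1 * q2])%N by rewrite chinese_remainder // e1 e2 !eqxx.
  by rewrite !modn_small // => /eqP.
- move=> a; rewrite coprimeMr => /andP[a1 a2] /=.
  rewrite coprime_sym in cop12; rewrite coprime_sym in cop21.
  by rewrite !coprime_modl coprimeMl a1 cop12 coprimeMl a2 cop21.
- by move=> u _; rewrite mulr_ge0 // divr_ge0 ?exprn_ge0 ?normc_ge0.
Qed.

(** As [primes 0] is empty, 0 counts as smooth; the sums over smooth q therefore carry the condition
    [0 < q]. *)
Definition smooth (m q : nat) : bool := all (fun p => (p < m)%N) (primes q).

(** Write q = m^k q' with q' coprime to m. Both k and q' stay below X, and the sum is then enlarged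
    to all pairs (k, q'). *)
Lemma smooth_sum_step m X : prime m ->
  \sum_(q < X | (0 < q)%N && smooth m.+1 q) sing_at q <=
  (1 + \sum_(1 <= k < X) sing_at (m ^ k)) *
  \sum_(q < X | (0 < q)%N && smooth m q) sing_at q.
Proof.
case: X => [|X] m_pr; first by rewrite !big_ord0 mulr0.
pose f (q : 'I_X.+1) : 'I_X.+1 * 'I_X.+1 :=
  (inord (logn m q), inord (q %/ m ^ logn m q)).
have fP (q : 'I_X.+1) : (0 < q)%N ->
    [/\ (f q).1 = logn m q :> nat, (q = m ^ (f q).1 * (f q).2 :> nat)%N,
        (0 < (f q).2)%N & coprime m (f q).2].
  move=> q0; have [q' mq' qE] := pfactor_coprime m_pr q0.
  have k_lt : (logn m q < X.+1)%N by apply: leq_ltn_trans (ltn_ord q); exact: ltnW (ltn_logl _ _).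
  have mk0 : (0 < m ^ logn m q)%N by rewrite expn_gt0 prime_gt0.
  have q'E : (q %/ m ^ logn m q = q')%N by rewrite {1}qE mulnK.
  have q'0 : (0 < q')%N by move: q0; rewrite qE muln_gt0 => /andP[].
  have q'_lt : (q' < X.+1)%N.
    by apply: leq_ltn_trans (ltn_ord q); rewrite qE leq_pmulr.
  by rewrite /f /= q'E !inordK //; split=> //; rewrite mulnC.
apply: le_trans (_ : \sum_(q < X.+1 | (0 < q)%N && smooth m.+1 q)
    sing_at (m ^ (f q).1) * sing_at (f q).2 <= _).
  apply: ler_sum => q /andP[q0 _]; have [_ qE f0 mf] := fP q q0.
  rewrite {1}qE; apply: sing_at_mul => //; first by rewrite expn_gt0 prime_gt0.
  by rewrite coprimeXl.
apply: le_trans (_ : \sum_(u : 'I_X.+1 * 'I_X.+1 | (0 < u.2)%N && smooth m u.2)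
    sing_at (m ^ u.1) * sing_at u.2 <= _).
  apply: (ler_sum_inj (f := f) (F := fun u => sing_at (m ^ u.1) * sing_at u.2)).
  - move=> a b /andP[a0 _] /andP[b0 _] e; apply/val_inj => /=.
    by have [_ -> _ _] := fP a a0; have [_ -> _ _] := fP b b0; rewrite e.
  - move=> q /andP[q0 /allP sm]; have [_ qE f0 mf] := fP q q0; rewrite f0 /=.
    apply/allP => p pf; have := pf; rewrite mem_primes => /and3P[p_pr _ pdv].
    have : p \in primes q by rewrite mem_primes p_pr q0 qE dvdn_mull.
    move=> /sm; rewrite ltnS leq_eqVlt => /orP[/eqP pm|//].
    by move: mf; rewrite -pm prime_coprime // pdv.
  - by move=> u _; rewrite mulr_ge0 ?sing_at_ge0.
rewrite -(pair_big predT (fun q : 'I_X.+1 => (0 < q)%N && smooth m q)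
  (fun k q : 'I_X.+1 => sing_at (m ^ k) * sing_at q)) /=.
under eq_bigr do rewrite -mulr_sumr.
rewrite -mulr_suml ler_wpM2r ?sumr_ge0 // => [q _|]; first exact: sing_at_ge0.
(* The exponent k = 0 accounts for the summand 1, as A(1) <= 1. *)
rewrite -(big_mkord predT (fun k => sing_at (m ^ k))) [X in X <= _]big_ltn // lerD2r expn0.
exact: sing_at_trivial.
Qed.

(** Induction on m: for m = 0 only q = 1 remains, a prime m contributes its factor by
    [smooth_sum_step], and any other m leaves the smooth numbers unchanged. *)
Lemma smooth_sum_le m X :
  \sum_(q < X | (0 < q)%N && smooth m q) sing_at q <=
  \prod_(0 <= p < m | prime p) (1 + \sum_(1 <= k < X) sing_at (p ^ k)).
Proof.
elim: m => [|m IH].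
  rewrite [X in _ <= X]big_geq //.
  have q1 q : (0 < q)%N -> smooth 0 q -> q = 1%N.
    move=> q0 /allP sm; apply/eqP; rewrite eqn_leq q0 andbT leqNgt; apply/negP => q1.
    have : pdiv q \in primes q by rewrite mem_primes pdiv_prime // q0 pdiv_dvd.
    by move=> /sm.
  have s1 : sing_at 1 <= 1 by exact: sing_at_trivial.
  apply: le_trans s1.
  apply: le_trans (_ : \sum_(q < X | (0 < q)%N && smooth 0 q) sing_at 1 <= _).
    by apply: ler_sum => q /andP[q0 /(q1 _ q0) ->].
  apply: le_trans (_ : \sum_(j : unit) sing_at 1 <= _).
    apply: (ler_sum_inj (f := fun=> tt) (F := fun=> sing_at 1)) => //.
      by move=> a b /andP[a0 /(q1 _ a0) a1] /andP[b0 /(q1 _ b0) b1] _; apply/val_inj; rewrite /= a1.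
    by move=> j _; exact: sing_at_ge0.
  by rewrite sumr_const card_unit.
rewrite [X in _ <= X]big_mkcond big_nat_recr //= -big_mkcond /=.
have a0 : 0 <= 1 + \sum_(1 <= k < X) sing_at (m ^ k).
  by rewrite addr_ge0 // sumr_ge0 // => k _; exact: sing_at_ge0.
case: (boolP (prime m)) => m_pr.
  by apply: le_trans (smooth_sum_step X m_pr) _; rewrite mulrC ler_wpM2r.
rewrite mulr1; apply: le_trans IH; rewrite le_eqVlt; apply/orP; left; apply/eqP.
apply: eq_bigl => q; congr (_ && _); apply: eq_in_all => p.
rewrite mem_primes => /andP[p_pr _]; rewrite ltnS leq_eqVlt.
by case: eqP => // pm; rewrite -pm p_pr in m_pr.
Qed.

End EulerProduct.

Theorem theorem2 (R : realType) (c : coeffs 9) :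
  symmetric_coeffs c ->
  davenport_geometric R c ->
  pair_hypothesis R c ->
  cvgn (series (sing_term R c)).
Proof.
move=> csym dgc pairs.
have [K K0 hK] := sing_at_prime_powers csym dgc.
have [B B0 hB] := prime_sum_bounded pairs.
apply: nondecreasing_is_cvgn.
  apply/nondecreasing_seqP => m; rewrite /series /= big_nat_recr //= lerDl.
  by apply: sumr_ge0 => a _; rewrite divr_ge0 ?exprn_ge0 ?sqrtr_ge0.
(* From 1 + t <= exp t, the Euler product is at most the exponential of the sum over all prime
   powers, which is at most [K * B]. *)
exists (expR (K * B)) => _ [m _ <-].
have -> : series (sing_term R c) m = \sum_(q < m.+1 | (0 < q)%N && smooth m.+1 q) sing_at R c q.
  (* Every positive q <= m has all its prime factors below m + 1, so smoothness is automatic in this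
     range. *)
  rewrite (eq_bigl (fun q : 'I_m.+1 => (0 < q)%N)) => [|q]; last first.
    case: posnP => //= q0; apply/allP => p; rewrite mem_primes => /and3P[_ _ pq].
    exact: leq_ltn_trans (dvdn_leq q0 pq) (ltn_ord q).
  rewrite big_mkcond big_ord_recl /= add0r /series /= big_mkord.
  by apply: eq_bigr => k _.
apply: le_trans (@smooth_sum_le R c csym m.+1 m.+1) _.
apply: le_trans (_ : \prod_(0 <= p < m.+1 | prime p)
   expR (\sum_(1 <= k < m.+1) sing_at R c (p ^ k)) <= _).
  apply: ler_prod => p _; rewrite expR_ge1Dx andbT.
  by rewrite addr_ge0 // sumr_ge0 // => k _; exact: sing_at_ge0.
rewrite -expR_sum ler_expR.
apply: le_trans (_ : \sum_(0 <= p < m.+1 | prime p) K * prime_weight R c p <= _).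
  by apply: ler_sum => p p_pr; exact: hK.
by rewrite -mulr_sumr ler_wpM2l.
Qed.
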